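(* Let $J\triangleleft A_d$ be a closed homogeneous ideal. If $J$ is generated (as a closed ideal) by monomials, or if there exists a finite subset $\Lambda'\subset\Lambda$ such that $J$ is generated (as a closed ideal) by homogeneous polynomials in the noncommuting variables $(z_i)_{i\in\Lambda'}$, then $$J=I(V(J)).$$
   Context: Let $d$ be an arbitrary cardinal and $\Lambda$ an index set with $|\Lambda|=d$. Let $M_n(\mathbb{C})^d$ be the set of tuples $T=(T_i)_{i\in\Lambda}$ of $n\times n$ matrices defining a bounded row operator $\bigoplus_{i\in\Lambda}\mathbb{C}^n\to\mathbb{C}^n$, and let $\|T\|$ be the norm of this row operator. The nc open unit ball is $\mathfrak{B}_d=\bigsqcup_{n\ge1}\{T\in M_n(\mathbb{C})^d:\|T\|<1\}$. An nc function on $\mathfrak{B}_d$ is a map $f$ sending $n\times n$ tuples to $n\times n$ matrices, with $f(T\oplus U)=f(T)\oplus f(U)$ and $f(R^{-1}TR)=R^{-1}f(T)R$ whenever $R$ is an invertible matrix and $T,R^{-1}TR\in\mathfrak{B}_d$. It is uniformly continuous if for every $\epsilon>0$ there is $\delta>0$ such that for all $n$ and all $T,U\in\mathfrak{B}_d$ of size $n$, $\|T-U\|<\delta$ implies $\|f(T)-f(U)\|<\epsilon$. $A_d=A(\mathfrak{B}_d)$ is the algebra of uniformly continuous nc functions on $\mathfrak{B}_d$ with the supremum norm; it equals the norm closure of the free polynomials in the noncommuting coordinate functions $z_i(T)=T_i$, $i\in\Lambda$. Every $f\in A_d$ has $n$-homogeneous components $f_n(T)=\frac1{2\pi}\int_0^{2\pi}f(e^{i\theta}T)e^{-in\theta}\,d\theta$,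 $n\ge 0$. A (two-sided) ideal $J\subseteq A_d$ is homogeneous if $f\in J$ implies $f_n\in J$ for all $n$. Monomials are finite products $z_{i_1}\cdots z_{i_k}$ of coordinate functions. For an ideal $J$, $V(J)=\{T\in\mathfrak{B}_d:f(T)=0\text{ for all }f\in J\}$, and for $\Omega\subseteq\mathfrak{B}_d$, $I(\Omega)=\{f\in A_d:f(T)=0\text{ for all }T\in\Omega\}$. *)

(* Defs.v *)
From HB Require Import structures.
From mathcomp Require Import all_boot all_order all_algebra finmap.
From mathcomp Require Import complex.
From mathcomp Require Import all_classical all_reals all_analysis.

Set Implicit Arguments.
Unset Strict Implicit.
Unset Printing Implicit Defensive.

Import Order.TTheory GRing.Theory Num.Theory.
Import Normc.

Local Open Scope classical_set_scope.
Local Open Scope ring_scope.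
Local Open Scope complex_scope.

(* The complex numbers are [R[i]] for [R : realType], and the index set is an
   arbitrary [L : choiceType] (possibly infinite or empty).  Matrix sizes range
   over [n.+1], so that level [n] below consists of matrices of size n + 1. *)

Section Norms.
Variable R : realType.

Definition l2norm (n : nat) (v : 'cV[R[i]]_n) : R :=
  Num.sqrt (\sum_(i < n) normc (v i ord0) ^+ 2).

Definition opnorm (n : nat) (A : 'M[R[i]]_n) : \bar R :=
  ereal_sup [set (l2norm (A *m v))%:E | v in [set v | l2norm v <= 1]].

(* The norm of the row operator (v_i)_i |-> sum_i T_i v_i on the Hilbert space
   direct sum, computed on the dense subspace of finitely supported vectors.
   It is +oo exactly when T does not define a bounded row operator. *)
Definition rownorm (L : choiceType) (n : nat) (T : L -> 'M[R[i]]_n) : \bar R :=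
  ereal_sup [set x | exists (s : {fset L}) (v : L -> 'cV[R[i]]_n),
    \sum_(i <- s) l2norm (v i) ^+ 2 <= 1 /\
    x = (l2norm (\sum_(i <- s) T i *m v i))%:E].

Lemma l2normZ n (c : R[i]) (v : 'cV[R[i]]_n) :
  l2norm (c *: v) = normc c * l2norm v.
Proof.
have c0 : 0 <= normc c by case: c => a b; rewrite /= sqrtr_ge0.
rewrite /l2norm -[normc c in RHS]ger0_norm // -sqrtr_sqr -sqrtrM ?sqr_ge0 //.
by rewrite mulr_sumr; congr Num.sqrt; apply: eq_bigr => i _; rewrite mxE normcM exprMn.
Qed.

Lemma rownorm_scale_le (L : choiceType) n (c : R[i]) (T : L -> 'M[R[i]]_n) :
  normc c = 1 -> (rownorm (fun i => c *: T i) <= rownorm T)%E.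
Proof.
move=> c1; apply: ge_ereal_sup => _ [s [v [hv ->]]].
apply: ereal_sup_ubound; exists s, (fun i => c *: v i); split.
  by under eq_bigr do rewrite l2normZ c1 mul1r.
by congr (l2norm _)%:E; apply: eq_bigr => i _; rewrite -scalemxAl scalemxAr.
Qed.

Definition expi (t : R) : R[i] := cos t +i* sin t.

Lemma normc_expi t : normc (expi t) = 1.
Proof. by rewrite /= cos2Dsin2 sqrtr1. Qed.

(* Integral over [0, 2 pi] with respect to Lebesgue measure. *)
Definition cintegral (g : R -> R[i]) : R[i] :=
  Rintegral lebesgue_measure `[0, 2 * pi]%classic (fun t => complex.Re (g t)) +i*
  Rintegral lebesgue_measure `[0, 2 * pi]%classic (fun t => complex.Im (g t)).

End Norms.

Section NCFunctions.
Variables (R : realType) (L : choiceType).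

Definition ncball (n : nat) : Type :=
  {T : L -> 'M[R[i]]_n.+1 | (rownorm T < 1)%E}.

Definition ncmap : Type := forall n : nat, ncball n -> 'M[R[i]]_n.+1.

HB.instance Definition _ := gen_eqMixin ncmap.
HB.instance Definition _ := gen_choiceMixin ncmap.

Implicit Types f g h : ncmap.

Lemma ncmapP f g : (forall n T, f n T = g n T) -> f = g.
Proof.
move=> fg; apply: functional_extensionality_dep => n.
by apply: functional_extensionality_dep => T; exact: fg.
Qed.

Definition ncmap_zero : ncmap := fun n T => 0.
Definition ncmap_one : ncmap := fun n T => 1.
Definition ncmap_opp f : ncmap := fun n T => - f n T.
Definition ncmap_add f g : ncmap := fun n T => f n T + g n T.
Definition ncmap_mul f g : ncmap := fun n T => f n T * g n T.
Definition ncmap_scale (a : R[i]) f : ncmap := fun n T => a *: f n T.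

Let addA : associative ncmap_add.
Proof. by move=> f g h; apply: ncmapP => n T; exact: addrA. Qed.
Let addC : commutative ncmap_add.
Proof. by move=> f g; apply: ncmapP => n T; exact: addrC. Qed.
Let add0 : left_id ncmap_zero ncmap_add.
Proof. by move=> f; apply: ncmapP => n T; exact: add0r. Qed.
Let addN : left_inverse ncmap_zero ncmap_opp ncmap_add.
Proof. by move=> f; apply: ncmapP => n T; exact: addNr. Qed.

HB.instance Definition _ := GRing.isZmodule.Build ncmap addA addC add0 addN.

Let mulA : associative ncmap_mul.
Proof. by move=> f g h; apply: ncmapP => n T; exact: mulrA. Qed.
Let mul1 : left_id ncmap_one ncmap_mul.
Proof. by move=> f; apply: ncmapP => n T; exact: mul1r. Qed.
Let mulx1 : right_id ncmap_one ncmap_mul.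
Proof. by move=> f; apply: ncmapP => n T; exact: mulr1. Qed.
Let mulDl : left_distributive ncmap_mul +%R.
Proof. by move=> f g h; apply: ncmapP => n T; exact: mulrDl. Qed.
Let mulDr : right_distributive ncmap_mul +%R.
Proof. by move=> f g h; apply: ncmapP => n T; exact: mulrDr. Qed.

HB.instance Definition _ :=
  GRing.Zmodule_isPzRing.Build ncmap mulA mul1 mulx1 mulDl mulDr.

Let scaleA a b f : ncmap_scale a (ncmap_scale b f) = ncmap_scale (a * b) f.
Proof. by apply: ncmapP => n T; exact: scalerA. Qed.
Let scale1 : left_id 1 ncmap_scale.
Proof. by move=> f; apply: ncmapP => n T; exact: scale1r. Qed.
Let scaleDr : right_distributive ncmap_scale +%R.
Proof. by move=> a f g; apply: ncmapP => n T; exact: scalerDr. Qed.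
Let scaleDl f : {morph ncmap_scale^~ f : a b / a + b}.
Proof. by move=> a b; apply: ncmapP => n T; exact: scalerDl. Qed.

HB.instance Definition _ := GRing.Zmodule_isLmodule.Build R[i] ncmap
  scaleA scale1 scaleDr scaleDl.

(* The point [W] is the direct sum of [T] and [U]; note that
   [(m.+1 + n.+1)%N] is convertible to [(m + n.+1).+1]. *)
Definition preserves_dsum f : Prop :=
  forall (m n : nat) (T : ncball m) (U : ncball n) (W : ncball (m + n.+1)),
    (forall i, sval W i = block_mx (sval T i) 0 0 (sval U i)) ->
    f _ W = block_mx (f m T) 0 0 (f n U).

Definition preserves_sim f : Prop :=
  forall (n : nat) (T U : ncball n) (S : 'M[R[i]]_n.+1), S \in unitmx ->
    (forall i, sval U i = invmx S *m sval T i *m S) ->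
    f n U = invmx S *m f n T *m S.

Definition nc_function f : Prop := preserves_dsum f /\ preserves_sim f.

Definition nc_unif_continuous f : Prop :=
  forall e : R, 0 < e -> exists2 d : R, 0 < d &
    forall (n : nat) (T U : ncball n),
      (rownorm (sval T - sval U)%R < d%:E)%E ->
      (opnorm (f n T - f n U)%R < e%:E)%E.

Definition Ad : set ncmap := [set f | nc_function f /\ nc_unif_continuous f].

Definition supnorm f : \bar R :=
  ereal_sup [set x | exists (n : nat) (T : ncball n), x = opnorm (f n T)].

Definition nc_ideal (J : set ncmap) : Prop :=
  [/\ J `<=` Ad, J 0,
      (forall f g, J f -> J g -> J (f + g)),
      (forall (a : R[i]) f, J f -> J (a *: f)) &
      (forall f g, Ad f -> J g -> J (f * g) /\ J (g * f))].

Definition nc_closed (J : set ncmap) : Prop :=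
  forall f, Ad f ->
    (forall e : R, 0 < e -> exists2 g, J g & (supnorm (f - g)%R < e%:E)%E) -> J f.

Definition closed_ideal (J : set ncmap) : Prop := nc_ideal J /\ nc_closed J.

Lemma rotate_subproof n (t : R) (T : ncball n) :
  (rownorm (fun i => expi t *: sval T i) < 1)%E.
Proof.
by apply: le_lt_trans (svalP T); apply: rownorm_scale_le; exact: normc_expi.
Qed.

Definition rotate n (t : R) (T : ncball n) : ncball n :=
  exist _ (fun i => expi t *: sval T i) (rotate_subproof t T).

Definition hcomp (k : nat) f : ncmap := fun n T =>
  ((2 * pi)^-1)%:C *:
  \matrix_(a, b) cintegral (fun t => f n (rotate t T) a b * expi (- (k%:R * t))).

Definition homogeneous (J : set ncmap) : Prop :=
  forall f, J f -> forall k : nat, J (hcomp k f).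

Definition zcoord (i : L) : ncmap := fun n T => sval T i.

Definition monomial (w : seq L) : ncmap := \prod_(i <- w) zcoord i.

Definition homogeneous_poly_in (L' : {fset L}) : set ncmap :=
  [set p | exists (k : nat) (s : seq (seq L)) (c : seq L -> R[i]),
    (forall w, w \in s -> size w = k /\ {subset w <= L'}) /\
    p = \sum_(w <- s) c w *: monomial w].

Definition generated_by (J G : set ncmap) : Prop := J = smallest closed_ideal G.

Definition ncV (J : set ncmap) : forall n : nat, set (ncball n) :=
  fun n => [set T | forall f, J f -> f n T = 0].

Definition ncI (Omega : forall n : nat, set (ncball n)) : set ncmap :=
  [set f | Ad f /\ forall n (T : ncball n), Omega n T -> f n T = 0].

End NCFunctions.

(* Main.v *)
Require Import Defs.
From mathcomp Require Import all_boot all_order all_algebra finmap.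
From mathcomp Require Import complex ring lra.
From mathcomp Require Import all_classical all_reals all_analysis.

Set Implicit Arguments.
Unset Strict Implicit.
Unset Printing Implicit Defensive.

Import Order.TTheory GRing.Theory Num.Theory.
Import Normc numFieldNormedType.Exports.

Local Open Scope classical_set_scope.
Local Open Scope ring_scope.
Local Open Scope complex_scope.

(** Let [f] be in [A_d] and vanish on [V(J)].  The point is to show that [f] is a
    uniform limit of polynomials lying in [J]; everything rests on feeding [f]
    with suitable matrices and on the fact that noncommutative functions respect
    intertwiners: [T_i X = X U_i] for all [i] implies [f(T) X = X f(U)]
    ([nc_intertwine]).

    Power series.  Let [W] be the cyclic shift of [C^m] with one weight [rho ^ m]
    and the others [1].  The row vector [(1, rho, rho ^ 2, ...)] is a left
    eigenvector of [W] for the eigenvalue [rho], so [f(rho T)] is read off from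
    [f] at the tensor product of [T] and [W] ([georow_wshift]).  As [rho ^ m] tends
    to [0], uniform continuity replaces [W] by the nilpotent shift, at an error
    that does not depend on [T].  A nilpotent tuple in finitely many variables is
    the image of the creation operators on a truncated Fock space, by the
    intertwiner sending a word [w] to [T^w v]; hence the value at the nilpotent
    shift is a polynomial, whose coefficients are those of [f] applied to the
    vacuum ([wshift_value]).  So [f(rho T)] is uniformly close to a truncated
    power series [sum_w rho ^ |w| c_w T^w], for [T] supported on finitely many
    variables ([dilation_expansion]).

    Infinitely many variables.  Boundedness of [f] makes the weighted coefficients
    square-summable ([coef_l2_bound]), and words of a given length evaluate to a
    row contraction, so that truncating the sum to the words over a large finite
    set [F] of letters is again uniform in [T].  As tuples with finite support are
    dense, [f] is a uniform limit of such truncations ([poly_approx]).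

    Membership in [J].  Fix [F] and [m], and consider the polynomials over [F] of
    degree at most [m] modulo those whose homogeneous components belong to [J].
    Multiplication by the variables on this finite-dimensional quotient is a
    nilpotent tuple, which a scalar brings into the ball.  It belongs to [V(J)]:
    the generators act by zero, those that are polynomials over [F] because the
    ideal is two-sided, those that are monomials containing a letter outside [F]
    because that letter acts by zero.  Thus [f] vanishes there; but its value at
    the class of [1] is the class of the truncated power series of [f], whose
    homogeneous components therefore lie in [J] ([homogeneous_part_in_ideal]).
    Both kinds of generating sets allow arbitrarily large [F], and [J] is closed. *)

(** * Hilbert space norms and row operators *)

Section HilbertNorms.
Variable R : realType.
Implicit Types (x y : R[i]) (n : nat).

Lemma normc_ge0 x : 0 <= normc x.
Proof. by case: x => a b; rewrite /= sqrtr_ge0. Qed.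

Lemma normcE x : `|x| = (normc x)%:C.
Proof. by case: x. Qed.

Lemma normcR (t : R) : normc t%:C = `|t|.
Proof. by rewrite /= expr0n addr0 sqrtr_sqr. Qed.

Lemma ler_normcD x y : normc (x + y) <= normc x + normc y.
Proof. by rewrite -lecR rmorphD /= -!normcE ler_normD. Qed.

Lemma ler_normc_sum (I : Type) (r : seq I) (P : pred I) (F : I -> R[i]) :
  normc (\sum_(i <- r | P i) F i) <= \sum_(i <- r | P i) normc (F i).
Proof.
elim/big_rec2 : _ => [|i a b _ ab]; first by rewrite normc0.
by apply: le_trans (ler_normcD _ _) _; rewrite lerD2l.
Qed.

Lemma cauchy_schwarz_sum (I : Type) (r : seq I) (P : pred I) (a b : I -> R) :
  (\sum_(i <- r | P i) a i * b i) ^+ 2 <=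
  (\sum_(i <- r | P i) a i ^+ 2) * (\sum_(i <- r | P i) b i ^+ 2).
Proof.
set A := \sum_(i <- r | P i) a i ^+ 2; set B := \sum_(i <- r | P i) b i ^+ 2.
set S := \sum_(i <- r | P i) a i * b i.
have quad t : 0 <= A - t *+ 2 * S + t ^+ 2 * B.
  have -> : A - t *+ 2 * S + t ^+ 2 * B =
            \sum_(i <- r | P i) (a i - t * b i) ^+ 2.
    rewrite /A /B /S !mulr_sumr -sumrB -big_split /=.
    by apply: eq_bigr => i _; ring.
  by apply: sumr_ge0 => i _; exact: sqr_ge0.
have A0 : 0 <= A by apply: sumr_ge0 => i _; exact: sqr_ge0.
have : 0 <= B by apply: sumr_ge0 => i _; exact: sqr_ge0.
rewrite le_eqVlt => /predU1P[B0|B0]; last first.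
  have := quad (S / B); rewrite -(pmulr_rge0 _ B0).
  have -> : B * (A - (S / B) *+ 2 * S + (S / B) ^+ 2 * B) = A * B - S ^+ 2.
    by field; rewrite gt_eqF.
  by rewrite subr_ge0.
(* with [B = 0] the quadratic in [t] is affine, which forces [S = 0] *)
suff -> : S = 0 by rewrite expr0n /= mulr_ge0// -B0.
apply/eqP/negPn/negP => S0.
have := quad ((A + 1) / (S *+ 2)); rewrite -B0 mulr0 addr0.
have -> : ((A + 1) / (S *+ 2)) *+ 2 * S = A + 1 by field.
lra.
Qed.

Lemma cauchy_schwarz_normc (I : Type) (r : seq I) (P : pred I)
    (a b : I -> R[i]) :
  normc (\sum_(i <- r | P i) a i * b i) ^+ 2 <=
  (\sum_(i <- r | P i) normc (a i) ^+ 2) *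
  (\sum_(i <- r | P i) normc (b i) ^+ 2).
Proof.
apply: le_trans (cauchy_schwarz_sum _ _ _ _).
rewrite ler_pXn2r// ?nnegrE ?normc_ge0//.
  by apply: le_trans (ler_normc_sum _ _ _) _; apply: ler_sum => i _; rewrite normcM.
by apply: sumr_ge0 => i _; rewrite mulr_ge0// normc_ge0.
Qed.

Lemma l2norm_ge0 n (v : 'cV[R[i]]_n) : 0 <= l2norm v.
Proof. exact: sqrtr_ge0. Qed.
#[local] Hint Resolve l2norm_ge0 normc_ge0 : core.

Lemma l2norm_sqr n (v : 'cV[R[i]]_n) :
  l2norm v ^+ 2 = \sum_(i < n) normc (v i ord0) ^+ 2.
Proof. by rewrite sqr_sqrtr// sumr_ge0// => i _; rewrite sqr_ge0. Qed.

Lemma l2norm0 n : l2norm (0 : 'cV[R[i]]_n) = 0.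
Proof.
rewrite /l2norm big1 ?sqrtr0// => i _.
by rewrite mxE normc0 expr0n.
Qed.

Lemma l2norm_eq0 n (v : 'cV[R[i]]_n) : l2norm v = 0 -> v = 0.
Proof.
move=> v0; have : l2norm v ^+ 2 == 0 by rewrite v0 expr0n.
rewrite l2norm_sqr psumr_eq0 => [/allP h|i _]; last exact: sqr_ge0.
apply/matrixP => i j; rewrite ord1 mxE.
have := h i (mem_index_enum _); rewrite /= sqrf_eq0 => /eqP.
exact: eq0_normc.
Qed.

Lemma ler_l2sqr (a b : R) : 0 <= b -> a ^+ 2 <= b ^+ 2 -> a <= b.
Proof.
move=> b0 ab; have [a0|a0] := leP 0 a; last exact: le_trans (ltW a0) b0.
by move: ab; rewrite ler_pXn2r.
Qed.

Lemma ler_l2normD n (u v : 'cV[R[i]]_n) : l2norm (u + v) <= l2norm u + l2norm v.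
Proof.
apply: ler_l2sqr; first by rewrite addr_ge0.
rewrite sqrrD !l2norm_sqr.
have cs : \sum_(i < n) normc (u i ord0) * normc (v i ord0) <= l2norm u * l2norm v.
  apply: ler_l2sqr; first by rewrite mulr_ge0.
  by rewrite exprMn !l2norm_sqr cauchy_schwarz_sum.
apply: (@le_trans _ _ (\sum_(i < n) (normc (u i ord0) + normc (v i ord0)) ^+ 2)).
  apply: ler_sum => i _; rewrite mxE ler_pXn2r// ?nnegrE// ?addr_ge0//.
  exact: ler_normcD.
under eq_bigr do rewrite sqrrD.
by rewrite !big_split/= lerD2r lerD2l mulr2n lerD.
Qed.

Lemma ler_l2norm_sum n (I : Type) (r : seq I) (P : pred I)
    (F : I -> 'cV[R[i]]_n) :
  l2norm (\sum_(i <- r | P i) F i) <= \sum_(i <- r | P i) l2norm (F i).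
Proof.
elim/big_rec2 : _ => [|i a b _ ab]; first by rewrite l2norm0.
by apply: le_trans (ler_l2normD _ _) _; rewrite lerD2l.
Qed.

Lemma normc_le_l2norm n (v : 'cV[R[i]]_n) i : normc (v i ord0) <= l2norm v.
Proof.
apply: ler_l2sqr => //; rewrite l2norm_sqr (bigD1 i)//= lerDl.
by apply: sumr_ge0 => j _; exact: sqr_ge0.
Qed.

Lemma l2norm_col_mx m n (u : 'cV[R[i]]_m) (v : 'cV[R[i]]_n) :
  l2norm (col_mx u v) ^+ 2 = l2norm u ^+ 2 + l2norm v ^+ 2.
Proof.
rewrite !l2norm_sqr big_split_ord/=.
by congr (_ + _); apply: eq_bigr => i _; rewrite (col_mxEu, col_mxEd).
Qed.

(** Operator norm bounds are handled through this predicate, which also makes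
    sense for rectangular matrices and involves no extended real. *)
Definition opbound m n (A : 'M[R[i]]_(m, n)) (c : R) :=
  forall v : 'cV[R[i]]_n, l2norm (A *m v) <= c * l2norm v.

Lemma opnorm_le n (A : 'M[R[i]]_n) (c : R) :
  0 <= c -> opbound A c -> (opnorm A <= c%:E)%E.
Proof.
move=> c0 Ac; apply: ge_ereal_sup => _ [v /= v1 <-].
by rewrite lee_fin (le_trans (Ac v))// ler_piMr.
Qed.

Lemma opbound_opnorm n (A : 'M[R[i]]_n) (c : R) :
  (opnorm A <= c%:E)%E -> opbound A c.
Proof.
move=> Ac v; have [v0|v0] := eqVneq (l2norm v) 0.
  by rewrite v0 (l2norm_eq0 v0) mulmx0 l2norm0 mulr0.
have vp : 0 < l2norm v by rewrite lt_def v0 l2norm_ge0.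
pose w : 'cV[R[i]]_n := (l2norm v)^-1%:C *: v.
have w1 : l2norm w = 1.
  by rewrite l2normZ normcR ger0_norm ?invr_ge0// mulVf.
have : ((l2norm (A *m w))%:E <= c%:E)%E.
  by apply: le_trans Ac; apply: ereal_sup_ubound; exists w; rewrite //= w1.
rewrite lee_fin -scalemxAr l2normZ normcR ger0_norm ?invr_ge0//.
by rewrite mulrC ler_pdivrMr.
Qed.

Lemma opboundD m n (A B : 'M[R[i]]_(m, n)) a b :
  opbound A a -> opbound B b -> opbound (A + B) (a + b).
Proof.
move=> Aa Bb v; rewrite mulmxDl mulrDl.
by apply: le_trans (ler_l2normD _ _) _; rewrite lerD.
Qed.

Lemma opboundZ m n (A : 'M[R[i]]_(m, n)) a c :
  opbound A a -> opbound (c *: A) (normc c * a).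
Proof. by move=> Aa v; rewrite -scalemxAl l2normZ -mulrA ler_wpM2l. Qed.

Lemma opboundM m n p (A : 'M[R[i]]_(m, n)) (B : 'M[R[i]]_(n, p)) a b :
  0 <= a -> opbound A a -> opbound B b -> opbound (A *m B) (a * b).
Proof.
move=> a0 Aa Bb v; rewrite -mulmxA -mulrA.
by apply: le_trans (Aa _) _; rewrite ler_wpM2l.
Qed.

Lemma opbound_le m n (A : 'M[R[i]]_(m, n)) a b :
  a <= b -> opbound A a -> opbound A b.
Proof. by move=> ab Aa v; apply: le_trans (Aa v) _; rewrite ler_wpM2r. Qed.

Lemma opbound_sum m n (I : Type) (r : seq I) (P : pred I)
    (A : I -> 'M[R[i]]_(m, n)) (a : I -> R) :
  (forall i, P i -> opbound (A i) (a i)) ->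
  opbound (\sum_(i <- r | P i) A i) (\sum_(i <- r | P i) a i).
Proof.
move=> Aa; elim/big_rec2 : _ => [v|i b B Pi Bb]; last exact: opboundD (Aa i Pi) Bb.
by rewrite mul0mx l2norm0 mul0r.
Qed.

(** The Cauchy-Schwarz inequality on each row of [A]. *)
Lemma opbound_hs m n (A : 'M[R[i]]_(m, n)) :
  opbound A (Num.sqrt (\sum_(i < m) \sum_(j < n) normc (A i j) ^+ 2)).
Proof.
set h := \sum_(i < m) _; move=> v.
have h0 : 0 <= h by do 2![apply: sumr_ge0 => ? _]; exact: sqr_ge0.
apply: ler_l2sqr; first by rewrite mulr_ge0// sqrtr_ge0.
rewrite exprMn (sqr_sqrtr h0) !l2norm_sqr mulr_suml; apply: ler_sum => i _.
by rewrite mxE cauchy_schwarz_normc.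
Qed.

Lemma opbound_small0 m n (A : 'M[R[i]]_(m, n)) :
  (forall e : R, 0 < e -> opbound A e) -> A = 0.
Proof.
move=> Ae; apply/matrixP => i j; rewrite [RHS]mxE.
apply: eq0_normc; apply/eqP; rewrite eq_le normc_ge0 andbT.
pose d : 'cV[R[i]]_n := delta_mx j ord0.
have dE : (A *m d) i ord0 = A i j by rewrite -colE mxE.
apply/ler_addgt0Pl => e e0; rewrite addr0 -dE.
have e'0 : 0 < e / (l2norm d + 1) by rewrite divr_gt0// ltr_wpDl.
apply: le_trans (normc_le_l2norm _ _) _; apply: le_trans (Ae _ e'0 d) _.
rewrite mulrAC ler_pdivrMr ?ltr_wpDl// ler_pM2l//.
by rewrite lerDl.
Qed.

End HilbertNorms.
#[global] Hint Extern 0 (is_true (0 <= l2norm _)) => exact: l2norm_ge0 : core.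
#[global] Hint Extern 0 (is_true (0 <= normc _)) => exact: normc_ge0 : core.

Section RowOperators.
Variables (R : realType) (L : choiceType).
Implicit Types (s F : {fset L}) (n : nat).

(** The bound [rownorm T <= r] in homogeneous form, free of any normalization of
    the vectors. *)
Definition rowbound n (T : L -> 'M[R[i]]_n) (r : R) :=
  forall s (v : L -> 'cV[R[i]]_n),
    l2norm (\sum_(i <- s) T i *m v i) ^+ 2 <=
    r ^+ 2 * \sum_(i <- s) l2norm (v i) ^+ 2.

Lemma rownorm_le n (T : L -> 'M[R[i]]_n) (r : R) :
  0 <= r -> rowbound T r -> (rownorm T <= r%:E)%E.
Proof.
move=> r0 Tr; apply: ge_ereal_sup => _ [s [v [v1 ->]]].
rewrite lee_fin; apply: ler_l2sqr => //.
by apply: le_trans (Tr s v) _; rewrite ler_piMr// sqr_ge0.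
Qed.

Lemma rownorm_ge0 n (T : L -> 'M[R[i]]_n) : (0 <= rownorm T)%E.
Proof.
apply: ereal_sup_ubound; exists fset0, (fun=> 0).
by rewrite !big_seq_fset0 l2norm0.
Qed.

Lemma rowbound_rownorm n (T : L -> 'M[R[i]]_n) (r : R) :
  0 <= r -> (rownorm T <= r%:E)%E -> rowbound T r.
Proof.
move=> r0 Tr s v; set q := \sum_(i <- s) l2norm _ ^+ 2.
have q0 : 0 <= q by apply: sumr_ge0 => i _; exact: sqr_ge0.
have [q0'|qN0] := eqVneq q 0.
  rewrite [X in l2norm X]big_seq big1 ?l2norm0 ?expr0n ?mulr_ge0 ?sqr_ge0// => i si.
  suff -> : v i = 0 by rewrite mulmx0.
  apply/l2norm_eq0/eqP; rewrite -sqrf_eq0.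
  move/eqP : q0'; rewrite psumr_eq0 => [/allP/(_ _ si)//|j _]; exact: sqr_ge0.
have qp : 0 < q by rewrite lt_def qN0.
pose a := (Num.sqrt q)^-1.
have a0 : 0 <= a by rewrite invr_ge0 sqrtr_ge0.
have a2 : a ^+ 2 = q^-1 by rewrite exprVn sqr_sqrtr.
have : ((l2norm (\sum_(i <- s) T i *m (a%:C *: v i)))%:E <= r%:E)%E.
  apply: le_trans Tr; apply: ereal_sup_ubound; exists s, (fun i => a%:C *: v i).
  split=> //; under eq_bigr do rewrite l2normZ exprMn normcR ger0_norm// a2.
  by rewrite -mulr_sumr -/q mulVf.
under eq_bigr do rewrite -scalemxAr.
rewrite -scaler_sumr lee_fin l2normZ normcR ger0_norm//.
move=> h; have : (a * l2norm (\sum_(i <- s) T i *m v i)) ^+ 2 <= r ^+ 2.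
  by rewrite ler_pXn2r ?nnegrE ?mulr_ge0.
by rewrite exprMn a2 mulrC ler_pdivrMr.
Qed.

Lemma rownorm_lt_rowbound n (T : L -> 'M[R[i]]_n) (c : R) :
  (rownorm T < c%:E)%E -> exists2 r : R, 0 <= r < c & rowbound T r.
Proof.
have := rownorm_ge0 T; case E : (rownorm T) => [r| |]//.
rewrite lee_fin lte_fin => r0 rc; exists r; first by rewrite r0.
by apply: rowbound_rownorm => //; rewrite E.
Qed.

Lemma rowbound_lt_rownorm n (T : L -> 'M[R[i]]_n) (r c : R) :
  0 <= r < c -> rowbound T r -> (rownorm T < c%:E)%E.
Proof.
by move=> /andP[r0 rc] Tr; apply: le_lt_trans (rownorm_le r0 Tr) _; rewrite lte_fin.
Qed.

Lemma rowboundP n (T : L -> 'M[R[i]]_n) (r : R) : 0 <= r -> rowbound T r ->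
  forall s v, l2norm (\sum_(i <- s) T i *m v i) <=
              r * Num.sqrt (\sum_(i <- s) l2norm (v i) ^+ 2).
Proof.
move=> r0 Tr s v; apply: ler_l2sqr; first by rewrite mulr_ge0// sqrtr_ge0.
rewrite exprMn [in leRHS]sqr_sqrtr ?Tr//.
by apply: sumr_ge0 => i _; exact: sqr_ge0.
Qed.

Lemma rowbound_le n (T : L -> 'M[R[i]]_n) (a b : R) :
  0 <= a <= b -> rowbound T a -> rowbound T b.
Proof.
move=> /andP[a0 ab] Ta s v; apply: le_trans (Ta s v) _; apply: ler_wpM2r.
  by apply: sumr_ge0 => i _; exact: sqr_ge0.
by rewrite ler_pXn2r// nnegrE (le_trans a0).
Qed.

Lemma rowboundZ n (T : L -> 'M[R[i]]_n) r (c : R[i]) :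
  rowbound T r -> rowbound (fun i => c *: T i) (normc c * r).
Proof.
move=> Tr s v; under eq_bigr do rewrite -scalemxAl.
rewrite -scaler_sumr l2normZ !exprMn -[leRHS]mulrA.
by rewrite ler_wpM2l ?sqr_ge0.
Qed.

Lemma rowbound_opbound n (T : L -> 'M[R[i]]_n) r i :
  0 <= r -> rowbound T r -> opbound (T i) r.
Proof.
move=> r0 Tr v; have := rowboundP r0 Tr (fset1 i) (fun=> v).
by rewrite !big_seq_fset1 sqrtr_sqr ger0_norm.
Qed.

Lemma rowbound_mull n (T : L -> 'M[R[i]]_n) (A : 'M[R[i]]_n) a r :
  0 <= a -> opbound A a -> rowbound T r -> rowbound (fun i => A *m T i) (a * r).
Proof.
move=> a0 Aa Tr s v; under eq_bigr do rewrite -mulmxA.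
rewrite -mulmx_sumr exprMn -mulrA.
apply: (@le_trans _ _ (a ^+ 2 * l2norm (\sum_(i <- s) T i *m v i) ^+ 2)).
  by rewrite -exprMn ler_pXn2r// ?nnegrE ?mulr_ge0.
by rewrite ler_wpM2l// sqr_ge0.
Qed.

Lemma rowbound_dsum m n (T : L -> 'M[R[i]]_m) (U : L -> 'M[R[i]]_n) r :
  rowbound T r -> rowbound U r ->
  rowbound (fun i => block_mx (T i) 0 0 (U i)) r.
Proof.
move=> Tr Ur s v.
have -> : \sum_(i <- s) block_mx (T i) 0 0 (U i) *m v i =
  col_mx (\sum_(i <- s) T i *m usubmx (v i)) (\sum_(i <- s) U i *m dsubmx (v i)).
  elim/big_rec3 : _ => [|i a b c _ ->]; first by rewrite col_mx0.
  by rewrite -{1}[v i]vsubmxK mul_block_col !mul0mx addr0 add0r add_col_mx.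
rewrite l2norm_col_mx; apply: le_trans (lerD (Tr _ _) (Ur _ _)) _.
rewrite -mulrDr -big_split/= le_eqVlt; apply/orP; left; apply/eqP.
by congr (_ * _); apply: eq_bigr => i _; rewrite -l2norm_col_mx vsubmxK.
Qed.

Definition restr n F (T : L -> 'M[R[i]]_n) : L -> 'M[R[i]]_n :=
  fun i => if i \in F then T i else 0.

Lemma rowbound_restr n F (T : L -> 'M[R[i]]_n) (r : R) :
  rowbound T r -> rowbound (restr F T) r.
Proof.
move=> Tr s v; rewrite /restr.
have := Tr s (fun i => if i \in F then v i else 0).
rewrite (_ : \sum_(i <- s) _ = \sum_(i <- s) restr F T i *m v i).
  move=> h; apply: le_trans h _; rewrite ler_wpM2l// ?sqr_ge0//; apply: ler_sum => i _.
  by case: ifP => // _; rewrite l2norm0 expr0n sqr_ge0.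
by apply: eq_bigr => i _; rewrite /restr; case: ifP; rewrite ?mulmx0 ?mul0mx.
Qed.

End RowOperators.

(** * Noncommutative functions *)

Section NCFunctionTheory.
Variables (R : realType) (L : choiceType).
Implicit Types (f g h : ncmap R L) (n : nat).

Definition ball_point n (T : L -> 'M[R[i]]_n.+1) r
    (r1 : 0 <= r < 1) (Tr : rowbound T r) : ncball R L n :=
  exist _ T (rowbound_lt_rownorm r1 Tr).

Lemma ncball_rowbound n (T : ncball R L n) :
  exists2 r : R, 0 <= r < 1 & rowbound (sval T) r.
Proof. exact: rownorm_lt_rowbound (svalP T). Qed.

(** The matrix [[1, X], [0, 1]] commutes with the direct sum of [T] and [U]
    exactly when [X] intertwines them; the two axioms of a noncommutative
    function then pass this commutation on to its values. *)
Lemma nc_intertwine f m n (T : ncball R L m) (U : ncball R L n)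
    (X : 'M[R[i]]_(m.+1, n.+1)) : nc_function f ->
  (forall i, sval T i *m X = X *m sval U i) -> f m T *m X = X *m f n U.
Proof.
move=> [fdsum fsim] TXU.
have [rT /andP[rT0 rT1] Tr] := ncball_rowbound T.
have [rU /andP[rU0 rU1] Ur] := ncball_rowbound U.
pose r := Num.max rT rU.
have r1 : 0 <= r < 1 by rewrite le_max rT0 gt_max rT1.
have Wr : rowbound (fun i => block_mx (sval T i) 0 0 (sval U i)) r.
  by apply: rowbound_dsum; [apply: rowbound_le Tr|apply: rowbound_le Ur];
    rewrite ?rT0 ?rU0 le_max lexx ?orbT.
pose W : ncball R L (m + n.+1) := @ball_point (m + n.+1) _ r r1 Wr.
pose S : 'M[R[i]]_(m.+1 + n.+1) := block_mx 1%:M X 0 1%:M.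
pose S' : 'M[R[i]]_(m.+1 + n.+1) :=
  block_mx 1%:M (- X) 0 1%:M.
have S'S : S' *m S = 1%:M.
  rewrite /S /S' (@mulmx_block _ m.+1 n.+1 m.+1 n.+1).
  rewrite !mul1mx !mulmx1 !mulmx0 !mul0mx !addr0 add0r subrr.
  by rewrite -(@scalar_mx_block _ m.+1 n.+1).
have SU : S \in unitmx by case: (mulmx1_unit S'S).
have S'E : invmx S = S'.
  by rewrite -[LHS]mul1mx -S'S mulmxK.
have fW := fdsum m n T U W (fun i => erefl).
have conjS (A : 'M[R[i]]_m.+1) (B : 'M[R[i]]_n.+1) :
    S' *m block_mx A 0 0 B *m S = block_mx A (A *m X - X *m B) 0 B.
  rewrite /S /S' !mulmx_block !mul1mx !mulmx1 !mulmx0 !mul0mx !addr0 !add0r.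
  by rewrite mul0mx add0r mulNmx.
have /(fsim _ W W S SU) : forall i, sval W i = invmx S *m sval W i *m S.
  move=> i; rewrite S'E; apply: (etrans _ (esym (conjS (sval T i) (sval U i)))).
  by rewrite TXU subrr.
rewrite S'E fW => h; have {}h := etrans h (conjS (f m T) (f n U)).
by have [_ /esym/eqP + _ _] := @eq_block_mx _ m.+1 n.+1 m.+1 n.+1 _ _ _ _ _ _ _ _ h; rewrite subr_eq0 => /eqP.
Qed.

Lemma Ad_nc f : Ad f -> nc_function f. Proof. by case. Qed.

Lemma Ad_unif f : Ad f -> forall e : R, 0 < e -> exists2 d : R, 0 < d &
  forall n (T U : ncball R L n) (r : R), 0 <= r < d ->
    rowbound (fun i => sval T i - sval U i) r -> opbound (f n T - f n U) e.
Proof.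
move=> [_ fu] e e0; have [d d0 fd] := fu e e0; exists d => // n T U r rd TUr.
by apply: opbound_opnorm; apply/ltW/fd; exact: rowbound_lt_rownorm rd TUr.
Qed.

Lemma Ad_intro f : nc_function f ->
  (forall e : R, 0 < e -> exists2 d : R, 0 < d &
     forall n (T U : ncball R L n) (r : R), 0 <= r < d ->
     rowbound (fun i => sval T i - sval U i) r -> opbound (f n T - f n U) e) ->
  Ad f.
Proof.
move=> fnc fu; split=> // e e0; have e2 : 0 < e / 2 by rewrite divr_gt0.
have [d d0 fd] := fu _ e2; exists d => // n T U.
move=> /rownorm_lt_rowbound[r rd TUr]; apply: (@le_lt_trans _ _ (e / 2)%:E).
  by apply: opnorm_le (ltW e2) _; exact: fd TUr.
by rewrite lte_fin ltr_pdivrMr// mulr_natr mulr2n ltrDl.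
Qed.

Lemma rowbound0 n : rowbound ((fun=> 0) : L -> 'M[R[i]]_n) 0.
Proof.
move=> s v; rewrite big1 ?l2norm0 ?expr0n ?mul0r// => i _.
by rewrite mul0mx.
Qed.

Lemma scale_point_subproof n (T : ncball R L n) (c : R) (c1 : 0 <= c <= 1) :
  (rownorm (fun i => c%:C *: sval T i) < 1)%E.
Proof.
have [r /andP[r0 r1] Tr] := ncball_rowbound T.
move/andP : c1 => [c0 c1].
apply: (rowbound_lt_rownorm _ (rowboundZ c%:C Tr)).
by rewrite normcR ger0_norm// mulr_ge0//= (le_lt_trans _ r1)// ler_piMl.
Qed.

Definition scale_point n (T : ncball R L n) (c : R) (c1 : 0 <= c <= 1) :
  ncball R L n := exist _ (fun i => c%:C *: sval T i) (scale_point_subproof T c1).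

(** Subdividing the segment from [0] to [T] into finitely many pieces, shorter
    than a modulus of continuity for [f], bounds [f n T - f n 0]; and the value
    at the origin of any size is determined by the value at the scalar origin. *)
Lemma Ad_bounded f : Ad f -> exists2 M : R, 0 <= M &
  forall n (T : ncball R L n), opbound (f n T) M.
Proof.
move=> fA; have [d d0 fd] := Ad_unif fA ltr01.
pose K := (Num.truncn d^-1).+1.
have dK : d^-1 < K%:R by exact: truncnS_gt.
have K0 : 0 < K%:R :> R by rewrite ltr0n.
have Kd : K%:R^-1 < d.
  by rewrite -[ltRHS]invrK ltf_pV2 ?posrE ?invr_gt0.
have z01 : ((0 : R) <= 0) && ((0 : R) < 1) by rewrite lexx ltr01.
pose O n : ncball R L n := ball_point z01 (@rowbound0 n.+1).
pose M0 := normc (f 0 (O 0%N) ord0 ord0).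
have fO n : opbound (f n (O n)) M0.
  move=> v; rewrite (nc_intertwine (U := O 0%N) (Ad_nc fA)) => [|i]; last first.
    by rewrite /= mul0mx mulmx0.
  by rewrite [f 0 _]mx11_scalar mul_mx_scalar l2normZ.
exists (M0 + K%:R) => [|n T]; first by rewrite addr_ge0 ?normc_ge0.
have [r /andP[r0 r1] Tr] := ncball_rowbound T.
have c01 j : (j <= K)%N -> 0 <= (j%:R / K%:R : R) <= 1.
  move=> jK; apply/andP; split; [by rewrite divr_ge0|].
  by rewrite ler_pdivrMr ?mul1r ?ler_nat.
have step j (jK : (j <= K)%N) :
    opbound (f n (scale_point T (c01 j jK))) (M0 + j%:R).
  elim: j jK => [|j IH] jK.
    rewrite addr0 (_ : scale_point _ _ = O n) //.
    by apply: eq_exist => /=; apply/funext => i; rewrite mul0r scale0r.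
  have /opboundD/(_ (IH (ltnW jK))) : opbound
      (f n (scale_point T (c01 j.+1 jK)) - f n (scale_point T (c01 j (ltnW jK)))) 1.
    apply: (fd _ _ _ K%:R^-1); first by rewrite invr_ge0 ltW.
    have -> : (fun i => sval (scale_point T (c01 j.+1 jK)) i -
        sval (scale_point T (c01 j (ltnW jK))) i) =
        (fun i => (K%:R^-1)%:C *: sval T i).
      apply/funext => i /=; rewrite -scalerBl -rmorphB/= -mulrBl.
      by rewrite -natrB// subSnn mul1r.
    apply: rowbound_le (rowboundZ _ Tr).
    have Ki0 : 0 <= K%:R^-1 :> R by rewrite invr_ge0 ltW.
    by rewrite normcR ger0_norm// mulr_ge0// ler_piMr// ltW.
  by rewrite subrK; apply: opbound_le; rewrite addrCA -[X in _ <= _ + X]natr1 [1 + _]addrC.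
have := step K (leqnn K); rewrite (_ : scale_point _ _ = T)//.
case: T {step Tr} => T hT; apply: eq_exist; apply/funext => i /=.
by rewrite divff ?gt_eqF// scale1r.
Qed.

Lemma ncmap0E n T : (0 : ncmap R L) n T = 0. Proof. by []. Qed.
Lemma ncmap1E n T : (1 : ncmap R L) n T = 1%:M. Proof. by []. Qed.
Lemma ncmapDE f g n T : (f + g) n T = f n T + g n T. Proof. by []. Qed.
Lemma ncmapBE f g n T : (f - g) n T = f n T - g n T. Proof. by []. Qed.
Lemma ncmapME f g n T : (f * g) n T = f n T *m g n T. Proof. by []. Qed.
Lemma ncmapZE a f n T : (a *: f) n T = a *: f n T. Proof. by []. Qed.

Lemma ncmap_sumE (I : Type) (r : seq I) (P : pred I) (F : I -> ncmap R L) n T :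
  (\sum_(i <- r | P i) F i) n T = \sum_(i <- r | P i) F i n T.
Proof. by elim/big_rec2 : _ => // i a b _ <-. Qed.

Lemma Ad_add f g : Ad f -> Ad g -> Ad (f + g).
Proof.
move=> fA gA; apply: Ad_intro.
  have [fd fs] := Ad_nc fA; have [gd gs] := Ad_nc gA; split.
    move=> m n T U W WE; have := fd _ _ _ _ _ WE; have := gd _ _ _ _ _ WE.
    rewrite !ncmapDE => -> ->.
    by rewrite (@add_block_mx _ m.+1 n.+1 m.+1 n.+1) !addr0.
  move=> n T U S SU UE; have := fs _ _ _ _ SU UE; have := gs _ _ _ _ SU UE.
  by rewrite !ncmapDE => -> ->; rewrite mulmxDr mulmxDl.
move=> e e0; have e2 : 0 < e / 2 by rewrite divr_gt0.
have [d d0 fd] := Ad_unif fA e2; have [d' d'0 gd] := Ad_unif gA e2.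
exists (Num.min d d') => [|n T U r /andP[r0]]; first by rewrite lt_min d0.
rewrite lt_min => /andP[rd rd'] TUr.
rewrite [X in opbound X](_ : _ = (f n T - f n U) + (g n T - g n U)); last first.
  by rewrite addrACA -opprD.
rewrite [e]splitr; apply: opboundD; [apply: fd TUr|apply: gd TUr]; exact/andP.
Qed.

Lemma Ad_scale a f : Ad f -> Ad (a *: f).
Proof.
move=> fA; apply: Ad_intro.
  have [fd fs] := Ad_nc fA; split.
    move=> m n T U W WE; have := fd _ _ _ _ _ WE.
    rewrite !ncmapZE => ->.
    by rewrite (@scale_block_mx _ m.+1 n.+1 m.+1 n.+1) !scaler0.
  move=> n T U S SU UE; have := fs _ _ _ _ SU UE.
  rewrite !ncmapZE => ->.
  by rewrite -scalemxAr -scalemxAl.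
move=> e e0; have a1 : 0 < normc a + 1 by rewrite ltr_wpDl.
have e2 : 0 < e / (normc a + 1) by rewrite divr_gt0.
have [d d0 fd] := Ad_unif fA e2.
exists d => // n T U r rd TUr.
rewrite [X in opbound X](_ : _ = a *: (f n T - f n U)); last by rewrite scalerBr.
apply: opbound_le (opboundZ _ (fd _ _ _ _ rd TUr)).
by rewrite mulrCA ler_piMr ?(ltW e0)// ler_pdivrMr// mul1r lerDl.
Qed.

Lemma Ad_mul f g : Ad f -> Ad g -> Ad (f * g).
Proof.
move=> fA gA; apply: Ad_intro.
  have [fd fs] := Ad_nc fA; have [gd gs] := Ad_nc gA; split.
    move=> m n T U W WE; have := fd _ _ _ _ _ WE; have := gd _ _ _ _ _ WE.
    rewrite !ncmapME => -> ->.
    apply: etrans (@mulmx_block _ m.+1 n.+1 m.+1 n.+1 m.+1 n.+1 _ _ _ _ _ _ _ _) _.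
    by rewrite !mulmx0 !mul0mx !addr0 !add0r.
  move=> n T U S SU UE; have := fs _ _ _ _ SU UE; have := gs _ _ _ _ SU UE.
  rewrite !ncmapME => -> ->.
  by rewrite !mulmxA mulmxK.
have [M M0 fM] := Ad_bounded fA; have [N N0 gN] := Ad_bounded gA.
move=> e e0; have MN : 0 < M + N + 1 by rewrite ltr_wpDl ?addr_ge0.
have e2 : 0 < e / (M + N + 1) by rewrite divr_gt0.
have [d d0 fd] := Ad_unif fA e2; have [d' d'0 gd] := Ad_unif gA e2.
exists (Num.min d d') => [|n T U r /andP[r0]]; first by rewrite lt_min d0.
rewrite lt_min => /andP[rd rd'] TUr.
rewrite [X in opbound X](_ : _ =
    (f n T - f n U) *m g n T + f n U *m (g n T - g n U)); last first.
  by rewrite mulmxBl mulmxBr addrA subrK.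
have fTU : opbound (f n T - f n U) (e / (M + N + 1)) by apply: fd TUr; rewrite r0.
have gTU : opbound (g n T - g n U) (e / (M + N + 1)) by apply: gd TUr; rewrite r0.
apply: opbound_le (opboundD (opboundM (ltW e2) fTU (gN n T))
                            (opboundM M0 (fM n U) gTU)).
rewrite [M * _]mulrC -mulrDr mulrAC ler_pdivrMr// ler_pM2l//.
by rewrite addrC lerDl.
Qed.

Lemma Ad_zcoord i : Ad (@zcoord R L i).
Proof.
apply: Ad_intro => [|e e0]; first by split=> [m n T U W|n T U S SU]; exact.
exists e => // n T U r /andP[r0 re] TUr.
by apply: opbound_le (rowbound_opbound i r0 TUr); exact: ltW.
Qed.

Lemma opbound_supnorm f n (T : ncball R L n) e :
  (supnorm f < e%:E)%E -> opbound (f n T) e.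
Proof.
move=> fe; apply: opbound_opnorm; apply: le_trans (ltW fe).
by apply: ereal_sup_ubound; exists n, T.
Qed.

Lemma supnorm_le f e : 0 <= e ->
  (forall n T, opbound (f n T) e) -> (supnorm f <= e%:E)%E.
Proof.
move=> e0 fe; apply: ge_ereal_sup => _ [n [T ->]]; exact: opnorm_le.
Qed.

Lemma Ad_0 : Ad (0 : ncmap R L).
Proof.
apply: Ad_intro => [|e e0].
  split=> [m n T U W _|n T U S _ _]; rewrite !ncmap0E ?mulmx0 ?mul0mx//.
  by rewrite (@block_mx0 _ m.+1 n.+1 m.+1 n.+1).
exists 1 => // n T U r _ _ v; rewrite subrr mul0mx l2norm0 mulr_ge0//.
exact: ltW.
Qed.

(** The closed ideal that reduces membership in the zero set of an ideal to its
    generators. *)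
Lemma closed_ideal_vanishing n (T : ncball R L n) :
  closed_ideal [set f | Ad f /\ f n T = 0].
Proof.
split.
  split=> [f []//||f g [fA fT] [gA gT]|a f [fA fT]|f g fA [gA gT]] /=.
  - by split=> //; exact: Ad_0.
  - by split; [exact: Ad_add|rewrite ncmapDE fT gT addr0].
  - by split; [exact: Ad_scale|rewrite ncmapZE fT scaler0].
  - split; split; first exact: Ad_mul.
    + by rewrite ncmapME gT mulmx0.
    + exact: Ad_mul.
    + by rewrite ncmapME gT mul0mx.
move=> f fA fe; split=> //; apply: opbound_small0 => e e0.
have [g [_ gT] fg] := fe e e0.
by have := opbound_supnorm T fg; rewrite ncmapBE gT subr0.
Qed.

End NCFunctionTheory.

(** * Words and the truncated Fock space *)

Section Words.
Variable L : choiceType.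
Implicit Types (F : {fset L}) (w : seq L) (r m : nat).

Fixpoint words F r : seq (seq L) :=
  if r is r'.+1 then [seq i :: w | i <- F, w <- words F r'] else [:: [::]].

Lemma mem_words F r w : (w \in words F r) = (size w == r) && all (mem F) w.
Proof.
elim: r w => [|r IH] [|i w] //=; first by apply/allpairsP => -[[]] /= ? ? [].
apply/allpairsP/idP => [[[j u]] /= [jF ur [-> ->]]|].
  by move: ur; rewrite IH jF eqSS.
move=> /andP[wr /andP[iF wF]]; exists (i, w); split => //=.
by rewrite IH wF andbT -eqSS.
Qed.

Lemma words_uniq F r : uniq (words F r).
Proof.
elim: r => //= r IH; apply: allpairs_uniq => //.
by move=> [i w] [j u] _ _ /= [-> ->].
Qed.

(** The empty word comes first, so that the number of words is a successor by
    computation. *)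
Definition fockwords F m : seq (seq L) :=
  flatten [seq words F r | r <- iota 0 m.+1].

Definition fockdim F m := (size (fockwords F m)).-1.

Lemma mem_fockwords F m w :
  (w \in fockwords F m) = (size w <= m)%N && all (mem F) w.
Proof.
apply/flatten_mapP/idP => [[r]|/andP[wm wF]].
  by rewrite mem_iota add0n ltnS /= mem_words => rm /andP[/eqP -> ->]; rewrite rm.
by exists (size w); rewrite ?mem_iota ?add0n ?ltnS// mem_words eqxx.
Qed.

Lemma big_fockwords (V : nmodType) F m (g : seq L -> V) :
  \sum_(w <- fockwords F m) g w = \sum_(r < m.+1) \sum_(w <- words F r) g w.
Proof. by rewrite big_flatten big_map -[iota 0 m.+1]/(index_iota 0 m.+1) big_mkord. Qed.

Lemma fockwords_uniq F m : uniq (fockwords F m).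
Proof.
rewrite /fockwords; elim: m.+1 0%N => //= n IH k; rewrite cat_uniq IH words_uniq.
rewrite andbT; apply/hasPn => w /flatten_mapP[r]; rewrite mem_iota => /andP[kr _].
rewrite !mem_words => /andP[/eqP -> _]; apply/nandP; left.
by rewrite gtn_eqF.
Qed.

Lemma fockwords_cons F m i w :
  i :: w \in fockwords F m -> (i \in F) /\ w \in fockwords F m.
Proof.
rewrite !mem_fockwords /= => /andP[iw /andP[iF wF]].
by rewrite (ltnW iw).
Qed.

Definition fword F m (x : 'I_(fockdim F m).+1) : seq L := nth [::] (fockwords F m) x.

Definition findex F m w : 'I_(fockdim F m).+1 := inord (index w (fockwords F m)).

Lemma mem_fword F m (x : 'I_(fockdim F m).+1) : fword x \in fockwords F m.
Proof. exact: mem_nth. Qed.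

Lemma findexK F m w : w \in fockwords F m -> fword (findex F m w) = w.
Proof.
by move=> wF; rewrite /fword inordK ?nth_index ?index_mem.
Qed.

Lemma fword_inj F m : injective (@fword F m).
Proof.
move=> x y /eqP; rewrite nth_uniq ?fockwords_uniq//; first by move/eqP/val_inj.
Qed.

Lemma fwordK F m (x : 'I_(fockdim F m).+1) : findex F m (fword x) = x.
Proof. by apply: fword_inj; rewrite findexK// mem_fword. Qed.

Lemma sum_fword (V : nmodType) F m (g : seq L -> V) :
  \sum_(x < (fockdim F m).+1) g (fword x) = \sum_(w <- fockwords F m) g w.
Proof. by rewrite [RHS](big_nth [::]) big_mkord. Qed.

Lemma sum_fword_eq (V : nmodType) F m w (g : 'I_(fockdim F m).+1 -> V) :
  \sum_(x | fword x == w) g x =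
  if w \in fockwords F m then g (findex F m w) else 0.
Proof.
case: ifPn => [wF|wNF]; last first.
  by rewrite big1// => x /eqP xE; move: wNF; rewrite -xE mem_fword.
rewrite (big_pred1 (findex F m w))// => x.
by rewrite -[RHS](inj_eq (@fword_inj F m)) findexK.
Qed.

Lemma sum_delta (K : pzRingType) F m w (g : 'I_(fockdim F m).+1 -> K) :
  \sum_x (fword x == w)%:R * g x =
  if w \in fockwords F m then g (findex F m w) else 0.
Proof.
rewrite -sum_fword_eq [RHS]big_mkcond; apply: eq_bigr => x _.
by case: eqP; rewrite (mul1r, mul0r).
Qed.

Lemma ler_sum_subset (K : numDomainType) (X : eqType) (s t : seq X) (a : X -> K) :
  uniq s -> {subset s <= t} -> (forall x, 0 <= a x) ->
  \sum_(x <- s) a x <= \sum_(x <- t) a x.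
Proof.
move=> + + a0; elim: s t => [|x s IH] t /=; first by rewrite big_nil sumr_ge0.
move=> /andP[xs us] st; have xt : x \in t by apply: st; rewrite mem_head.
rewrite big_cons (big_rem _ xt) /= lerD2l; apply: IH => // y ys.
apply: rem_mem; last by apply: st; rewrite inE ys orbT.
by apply: contraNneq xs => <-.
Qed.

End Words.

Section Fock.
Variables (R : realType) (L : choiceType).
Implicit Types (F : {fset L}) (w : seq L) (m n : nat) (f : ncmap R L).

Definition wprod n (T : L -> 'M[R[i]]_n) w : 'M[R[i]]_n :=
  foldr (fun i A => T i *m A) 1%:M w.

Lemma monomialE n (T : ncball R L n) w : @monomial R L w n T = wprod (sval T) w.
Proof.
rewrite /monomial; elim: w => [|i w IH]; first by rewrite big_nil.
by rewrite big_cons ncmapME IH.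
Qed.

(** The left creation operator of a letter on the truncated Fock space, in the
    basis of words. *)
Definition creation F m i : 'M[R[i]]_((fockdim F m).+1) :=
  \matrix_(x, y) (fword x == i :: fword y)%:R.

Lemma creationE F m i p (A : 'M[R[i]]_((fockdim F m).+1, p)) x b :
  (creation F m i *m A) x b =
  if fword x is j :: w then if j == i then A (findex F m w) b else 0 else 0.
Proof.
rewrite mxE; under eq_bigr do rewrite mxE.
case E : (fword x) => [|j w]; first by rewrite big1// => y _; rewrite mul0r.
have wF : w \in fockwords F m by case: (@fockwords_cons _ F m j w); rewrite -?E ?mem_fword.
have [->|ji] := eqVneq j i; last by rewrite big1// => y _; rewrite eqseq_cons (negPf ji) mul0r.
under eq_bigr do rewrite eqseq_cons eqxx /= eq_sym.
by rewrite sum_delta wF.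
Qed.

Lemma creation_notin F m i : i \notin F -> creation F m i = 0.
Proof.
move=> iNF; apply/matrixP => x y; rewrite !mxE.
case: eqP => // xE; have := mem_fword x; rewrite xE => /fockwords_cons[iF _].
by rewrite iF in iNF.
Qed.

(** The creation operators have pairwise orthogonal ranges, and each of them is
    a partial isometry. *)
Lemma rowbound_creation F m : rowbound (creation F m) 1.
Proof.
move=> s v; rewrite expr1n mul1r l2norm_sqr.
pose a w : R := if w is j :: u then normc (v j (findex F m u) ord0) ^+ 2 else 0.
pose P w := if w is j :: _ then j \in s else false.
have a0 w : 0 <= a w by case: w => //= j u; exact: sqr_ge0.
have -> : \sum_x normc ((\sum_(i <- s) creation F m i *m v i) x ord0) ^+ 2 =
    \sum_(w <- fockwords F m | P w) a w.
  rewrite [RHS]big_mkcond -sum_fword; apply: eq_bigr => x _.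
  rewrite summxE; under eq_bigr do rewrite creationE.
  case: (fword x) => [|j u] /=; first by rewrite big1 ?normc0 ?expr0n.
  case: ifPn => js; last first.
    rewrite big_seq big1 ?normc0 ?expr0n// => i si.
    by case: eqP => // ji; rewrite ji si in js.
  rewrite (big_rem _ js)/= eqxx big_seq big1 ?addr0// => i.
  rewrite mem_rem_uniq ?fset_uniq// inE => /andP[ij _].
  by rewrite eq_sym (negPf ij).
rewrite -big_filter.
apply: (@le_trans _ _ (\sum_(w <- [seq i :: u | i <- s, u <- fockwords F m]) a w)).
  apply: ler_sum_subset => //; first exact/filter_uniq/fockwords_uniq.
  move=> [|j u]; rewrite mem_filter => /andP[] // js /fockwords_cons[_ uF].
  by apply/allpairsP; exists (j, u).
rewrite big_flatten big_map; apply: ler_sum => i _.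
rewrite big_map l2norm_sqr -sum_fword.
by apply: ler_sum => x _; rewrite /a /= fwordK.
Qed.

Lemma fock_rowbound F m (t : R) : 0 <= t ->
  rowbound (fun i => t%:C *: creation F m i) t.
Proof.
move=> t0; apply: rowbound_le (rowboundZ _ (@rowbound_creation F m)).
by rewrite mulr1 normcR ger0_norm// t0 lexx.
Qed.

Definition fock_point F m (t : R) (t1 : 0 <= t < 1) : ncball R L (fockdim F m) :=
  ball_point t1 (@fock_rowbound F m t (proj1 (andP t1))).

(** In the larger Fock space the words outside the smaller one span an invariant
    subspace, since adding a letter in front of such a word never leads back;
    so the projection onto the smaller space is an intertwiner.  The diagonal
    matrix of the [(t / t') ^ |w|] corrects the change of scale. *)
Lemma fock_value_restrict f F F' m m' (t t' : R) (t1 : 0 <= t < 1)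
    (t1' : 0 <= t' < 1) w : nc_function f -> 0 < t' ->
  {subset F <= F'} -> (m <= m')%N -> w \in fockwords F m ->
  f _ (fock_point F m t1) (findex F m w) (findex F m [::]) =
  ((t / t') ^+ size w)%:C *
    f _ (fock_point F' m' t1') (findex F' m' w) (findex F' m' [::]).
Proof.
move=> fnc t'0 FF' mm' wF; set s := t / t'.
have sub u : u \in fockwords F m -> u \in fockwords F' m'.
  rewrite !mem_fockwords => /andP[um uF]; rewrite (leq_trans um mm')/=.
  by apply: sub_all uF => i; exact: FF'.
pose X : 'M[R[i]]_((fockdim F m).+1, (fockdim F' m').+1) :=
  \matrix_(x, y) ((fword y == fword x)%:R * (s ^+ size (fword x))%:C).
have XE p (A : 'M[R[i]]_((fockdim F' m').+1, p)) x b :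
    (X *m A) x b = (s ^+ size (fword x))%:C * A (findex F' m' (fword x)) b.
  rewrite mxE; under eq_bigr do rewrite mxE -mulrA.
  by rewrite sum_delta sub// mem_fword.
have e0 F1 m1 : [::] \in fockwords F1 m1 by rewrite mem_fockwords.
have := @nc_intertwine _ _ f _ _ (fock_point F m t1) (fock_point F' m' t1') X fnc.
move=> /(_ _)/matrixP/(_ (findex F m w) (findex F' m' [::])); rewrite XE findexK//.
move=> <- => [|i].
  rewrite mxE (bigD1 (findex F m [::]))//= mxE !findexK// eqxx mul1r mulr1.
  rewrite big1 ?addr0// => y y0; rewrite mxE findexK//.
  case: eqP => [yE|]; last by rewrite mul0r mulr0.
  by move: y0; rewrite yE fwordK eqxx.
apply/matrixP => x y /=; rewrite XE -scalemxAl [LHS]mxE creationE [in RHS]mxE [in RHS]mxE.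
rewrite findexK ?sub ?mem_fword//.
have xF := mem_fword x.
case E : (fword x) xF => [|j u] xF /=; first by rewrite !mulr0.
rewrite eqseq_cons mxE; have [_|ji] := eqVneq j i; last by rewrite !mulr0.
have [_ uF] := fockwords_cons xF.
rewrite findexK//= eq_sym; case: eqP => _; last by rewrite !(mul0r, mulr0).
rewrite !mulr1 mul1r -!rmorphM/= exprSr -mulrA divfK ?gt_eqF//.
by rewrite mulrC.
Qed.

Definition letters w : {fset L} := seq_fset tt w.

Lemma half01 : 0 <= (2^-1 : R) < 1.
Proof. by rewrite invr_ge0 ler0n /= invf_lt1 ?ltr1n. Qed.

(** The coefficient of [f] at [w] is read off at half the creation operators on a
    Fock space just large enough to contain [w]; by [fock_value] any other
    dilate on any other Fock space containing [w] gives the same number. *)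
Definition coef f w : R[i] :=
  (2 ^+ size w)%:C * f _ (fock_point (letters w) (size w) half01)
    (findex (letters w) (size w) w) (findex (letters w) (size w) [::]).

Lemma fock_value f F m t (t1 : 0 <= t < 1) w : nc_function f -> 0 < t ->
  w \in fockwords F m ->
  f _ (fock_point F m t1) (findex F m w) (findex F m [::]) =
  (t ^+ size w)%:C * coef f w.
Proof.
move=> fnc tp wF.
have h2 : (0 : R) < 2^-1 by rewrite invr_gt0.
have wL : w \in fockwords (letters w) (size w).
  by rewrite mem_fockwords leqnn /=; apply/allP => i; rewrite /= seq_fsetE.
have sub : {subset letters w <= F}.
  move=> i; rewrite seq_fsetE; move: wF; rewrite mem_fockwords => /andP[_ /allP].
  exact.
have wm : (size w <= m)%N by move: wF; rewrite mem_fockwords => /andP[].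
rewrite /coef mulrA -rmorphM/= -exprMn.
rewrite (@fock_value_restrict f _ F _ m _ t half01 t1)// mulrA -rmorphM/= -exprMn.
rewrite (_ : t * 2 * (2^-1 / t) = 1) ?expr1n ?mul1r//.
by field; rewrite gt_eqF.
Qed.

End Fock.

(** * Weighted cyclic shifts *)

Section WeightedShift.
Variables (R : realType) (L : choiceType).
Implicit Types (F : {fset L}) (w : seq L) (m n : nat) (f : ncmap R L).

(** The space [C^(m * n)] is the sum of [m] copies of [C^n], through
    [mxvec_index]. *)
Definition blockproj m n (r : 'I_m) : 'M[R[i]]_(n, m * n) :=
  \matrix_(a, k) (k == mxvec_index r a)%:R.

Definition blockinj m n (r : 'I_m) : 'M[R[i]]_(m * n, n) := (blockproj n r)^T.

Lemma blockprojE m n p (r : 'I_m) (A : 'M[R[i]]_(m * n, p)) a b :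
  (blockproj n r *m A) a b = A (mxvec_index r a) b.
Proof.
rewrite mxE (bigD1 (mxvec_index r a))//= mxE eqxx mul1r big1 ?addr0// => k kr.
by rewrite mxE (negPf kr) mul0r.
Qed.

Lemma blockprojK m n (r q : 'I_m) :
  blockproj n r *m blockinj n q = if r == q then 1%:M else 0.
Proof.
apply/matrixP => a b; rewrite blockprojE 2!mxE.
have -> : (mxvec_index r a == mxvec_index q b) = ((r, a) == (q, b)).
  by rewrite (inj_eq (@cast_ord_inj _ _ _)) (inj_eq enum_rank_inj).
by rewrite xpair_eqE; case: eqP => //= _; rewrite mxE.
Qed.

Lemma l2norm_blocks m n (v : 'cV[R[i]]_(m * n)) :
  l2norm v ^+ 2 = \sum_(r < m) l2norm (blockproj n r *m v) ^+ 2.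
Proof.
rewrite l2norm_sqr (reindex _ (curry_mxvec_bij m n)) /=.
under [RHS]eq_bigr do rewrite l2norm_sqr.
by rewrite [RHS]pair_bigA; apply: eq_bigr => -[r a] _; rewrite blockprojE.
Qed.

Lemma opbound_blockproj m n (r : 'I_m) : opbound (blockproj n r) 1.
Proof.
move=> v; rewrite mul1r; apply: ler_l2sqr => //.
rewrite (l2norm_blocks v) (bigD1 r)//= lerDl.
by apply: sumr_ge0 => q _; exact: sqr_ge0.
Qed.

Lemma opbound_blockinj m n (r : 'I_m) : opbound (blockinj n r) 1.
Proof.
move=> v; rewrite mul1r; apply: ler_l2sqr => //.
rewrite (l2norm_blocks (_ *m v)) (bigD1 r)//= mulmxA blockprojK eqxx mul1mx.
rewrite big1 ?addr0// => q qr.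
by rewrite mulmxA blockprojK (negPf qr) mul0mx l2norm0 expr0n.
Qed.

(** The tensor product of [T] with the weighted cyclic shift of weights [d]. *)
Definition wshift m n (d : 'I_m -> R) (T : L -> 'M[R[i]]_n) :
  L -> 'M[R[i]]_(m * n) :=
  fun i => \sum_(r < m) (d r)%:C *: (blockinj n r *m T i *m blockproj n (ord_pred r)).

Lemma blockproj_wshift m n (d : 'I_m -> R) (T : L -> 'M[R[i]]_n) i (r : 'I_m) :
  blockproj n r *m wshift d T i = (d r)%:C *: (T i *m blockproj n (ord_pred r)).
Proof.
rewrite /wshift mulmx_sumr (bigD1 r)//= big1 ?addr0 => [|q qr].
  by rewrite -scalemxAr !mulmxA blockprojK eqxx mul1mx.
by rewrite -scalemxAr !mulmxA blockprojK eq_sym (negPf qr) !mul0mx scaler0.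
Qed.

Lemma wshift_blockinj m n (d : 'I_m -> R) (T : L -> 'M[R[i]]_n) i (q : 'I_m) :
  wshift d T i *m blockinj n q = (d (ordS q))%:C *: (blockinj n (ordS q) *m T i).
Proof.
rewrite /wshift mulmx_suml (bigD1 (ordS q))//= big1 ?addr0 => [|r rq].
  by rewrite -scalemxAl -mulmxA blockprojK ordSK eqxx mulmx1.
rewrite -scalemxAl -mulmxA blockprojK ifN ?mulmx0 ?scaler0//.
by apply: contraNneq rq => <-; rewrite ord_predK.
Qed.

Lemma rowbound_wshift m n (d : 'I_m -> R) (T : L -> 'M[R[i]]_n) (c r : R) :
  (forall q : 'I_m, 0 <= d q <= c) -> rowbound T r ->
  rowbound (wshift d T) (c * r).
Proof.
move=> dc Tr s v; rewrite (l2norm_blocks (\sum_(i <- s) _)) exprMn.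
under [in leRHS]eq_bigr do rewrite l2norm_blocks.
rewrite exchange_big /= [in leRHS](reindex _ (onW_bij _ (ord_pred_bij m))) /=.
rewrite mulr_sumr.
apply: ler_sum => q _; rewrite mulmx_sumr.
under [in leLHS]eq_bigr do rewrite mulmxA blockproj_wshift -scalemxAl -mulmxA.
have /andP[d0 dqc] := dc q.
rewrite -scaler_sumr l2normZ exprMn normcR ger0_norm// -[leRHS]mulrA.
apply: ler_pM; rewrite ?sqr_ge0//.
by rewrite ler_pXn2r ?nnegrE// (le_trans d0).
Qed.

(** The weight [k] is on the wrap-around edge from the last block to the first. *)
Definition shift_weight m (k : R) (r : 'I_m) : R := if r == 0 :> nat then k else 1.

Lemma shift_weight01 m (k : R) (r : 'I_m) : 0 <= k <= 1 -> 0 <= shift_weight k r <= 1.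
Proof. by rewrite /shift_weight; case: ifP => // _ _; rewrite ler01 lexx. Qed.

Lemma wshiftB m n (k k' : R) (T : L -> 'M[R[i]]_n) i :
  wshift (@shift_weight m k) T i - wshift (@shift_weight m k') T i =
  wshift (fun r : 'I_m => if r == 0 :> nat then k - k' else 0) T i.
Proof.
rewrite -sumrB; apply: eq_bigr => r _; rewrite -scalerBl -rmorphB /=.
by rewrite /shift_weight; case: ifP => // _; rewrite subrr.
Qed.

Lemma wshift_rowbound1 m n (k r : R) (T : L -> 'M[R[i]]_n) :
  0 <= k <= 1 -> rowbound T r -> rowbound (wshift (@shift_weight m k) T) r.
Proof.
move=> k1 Tr; rewrite -[r]mul1r; apply: rowbound_wshift => // q.
exact: shift_weight01.
Qed.

Definition wshift_point m n (k r : R) (T : L -> 'M[R[i]]_n.+1)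
    (k1 : 0 <= k <= 1) (r1 : 0 <= r < 1) (Tr : rowbound T r) :
    ncball R L (n + m * n.+1) :=
  @ball_point R L (n + m * n.+1) _ r r1 (@wshift_rowbound1 m.+1 _ _ _ _ k1 Tr).

(** The tensor product of the row vector [(1, rho, rho ^ 2, ...)] and the identity. *)
Definition georow m n (rho : R) : 'M[R[i]]_(n, m * n) :=
  \sum_(r < m) (rho ^+ r)%:C *: blockproj n r.

Lemma georow_blockinj m n p rho (q : 'I_m) (A : 'M[R[i]]_(n, p)) :
  georow m n rho *m (blockinj n q *m A) = (rho ^+ q)%:C *: A.
Proof.
rewrite mulmxA /georow mulmx_suml (bigD1 q)//= big1 ?addr0 => [|r rq].
  by rewrite -scalemxAl blockprojK eqxx -scalemxAl mul1mx.
by rewrite -scalemxAl blockprojK (negPf rq) scaler0.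
Qed.

(** The wrap-around weight [rho ^ m.+1] is exactly what makes the truncated
    geometric sequence a left eigenvector of the cyclic shift. *)
Lemma georow_wshift m n rho (T : L -> 'M[R[i]]_n) i :
  georow m.+1 n rho *m wshift (shift_weight (rho ^+ m.+1)) T i =
  (rho%:C *: T i) *m georow m.+1 n rho.
Proof.
rewrite /georow mulmx_suml mulmx_sumr.
rewrite (reindex _ (onW_bij _ (Bijective (@ordSK m.+1) (@ord_predK m.+1)))) /=.
apply: eq_bigr => q _; rewrite -scalemxAl blockproj_wshift ordSK.
rewrite -scalemxAl -scalemxAr !scalerA -!rmorphM /=; congr (_%:C *: _).
rewrite /shift_weight /=; have [qm|] := eqVneq (q : nat) m.
  by rewrite qm modnn expr0 mul1r exprS.
move=> qm; have {}qm : (q < m)%N by rewrite ltn_neqAle qm -ltnS ltn_ord.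
by rewrite modn_small ?ltnS//= mulr1 exprS.
Qed.

Lemma georow_opbound m n (rho : R) : 0 <= rho < 1 ->
  opbound (georow m n rho) (1 - rho)^-1.
Proof.
move=> /andP[rho0 rho1].
apply: (@opbound_le _ _ _ _ (\sum_(r < m) rho ^+ r)); last first.
  apply: opbound_sum => r _.
  have := opboundZ (rho ^+ r)%:C (@opbound_blockproj m n r).
  by rewrite mulr1 normcR ger0_norm// exprn_ge0.
have d0 : 0 < 1 - rho by rewrite subr_gt0.
rewrite -[leRHS]mul1r ler_pdivlMr// -opprB mulrN mulrC -subrX1 opprB.
by rewrite lerBlDl lerDr exprn_ge0.
Qed.

Lemma wprod_cons n (T : L -> 'M[R[i]]_n) i w : wprod T (i :: w) = T i *m wprod T w.
Proof. by []. Qed.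

(** With the weight of the wrap-around set to [0] the shift is nilpotent, and
    the Fock space is its universal model: sending the word [w] to the vector
    [T^w v], placed in the block [|w|], intertwines the creation operators with
    the shift. *)
Lemma wshift_value f m F n (r : R) (T : L -> 'M[R[i]]_n.+1) (k1 : 0 <= (0 : R) <= 1)
    (r1 : 0 <= r < 1) (Tr : rowbound T r) (v : 'cV[R[i]]_n.+1) :
  nc_function f -> (forall i, i \notin F -> T i = 0) ->
  f _ (@wshift_point m _ _ _ T k1 r1 Tr) *m (blockinj n.+1 ord0 *m v) =
  \sum_(w <- fockwords F m)
    coef f w *: (blockinj n.+1 (inord (size w) : 'I_m.+1) *m (wprod T w *m v)).
Proof.
move=> fnc TF; set t : R := 2^-1.
have t0 : 0 < t by rewrite invr_gt0.
pose u w : 'cV[R[i]]_(m.+1 * n.+1) :=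
  blockinj n.+1 (inord (size w) : 'I_m.+1) *m (wprod T w *m v).
pose X : 'M[R[i]]_(m.+1 * n.+1, (fockdim F m).+1) :=
  \matrix_(k, x) ((t^-1 ^+ size (fword x))%:C *: u (fword x)) k ord0.
have XE (A : 'cV[R[i]]_(fockdim F m).+1) :
    X *m A = \sum_x A x ord0 *: ((t^-1 ^+ size (fword x))%:C *: u (fword x)).
  apply/matrixP => k b; rewrite ord1 mxE summxE; apply: eq_bigr => x _.
  by rewrite mxE [in RHS]mxE mulrC.
have e0 : [::] \in fockwords F m by rewrite mem_fockwords.
(* the columns of [X] are indexed by words; the scale compensates the factor [t]
   in front of the creation operators *)
have colX x : col x X = (t^-1 ^+ size (fword x))%:C *: u (fword x).
  by apply/matrixP => k b; rewrite ord1 !mxE.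
have X0 : col (findex F m [::]) X = blockinj n.+1 ord0 *m v.
  rewrite colX findexK// expr0 scale1r /u /= mul1mx.
  by congr (blockinj _ _ *m _); apply: val_inj; rewrite /= inordK.
have shiftu i w : (size w <= m)%N -> wshift (shift_weight 0) T i *m u w =
    if (size w < m)%N then u (i :: w) else 0.
  move=> wm; rewrite /u mulmxA wshift_blockinj -scalemxAl -!mulmxA /=.
  rewrite /shift_weight /= inordK ?ltnS//; case: ltnP => [wm'|mw].
    rewrite modn_small ?ltnS//= scale1r !mulmxA; congr (blockinj _ _ *m _ *m _ *m _).
    by apply: val_inj; rewrite /= !inordK ?modn_small.
  have -> : size w = m by apply/eqP; rewrite eqn_leq wm.
  by rewrite modnn/= scale0r.
have XI : f _ (wshift_point m k1 r1 Tr) *m X = X *m f _ (fock_point F m (half01 R)).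
  apply: nc_intertwine => // i.
  apply/(@trmx_inj _ _ _)/row_matrixP => x; rewrite -!tr_col; congr trmx.
  rewrite !colE -!mulmxA -!colE colX XE -scalemxAr.
  have := mem_fword x; rewrite mem_fockwords => /andP[xm xF].
  rewrite /= shiftu//.
  transitivity (\sum_(y < (fockdim F m).+1 | fword y == i :: fword x)
      (t * t^-1 ^+ size (fword y))%:C *: u (fword y)); last first.
    rewrite [LHS]big_mkcond; apply: eq_bigr => y _; rewrite !mxE scalerA.
    case: eqP => _; last by rewrite mulr0 mul0r scale0r.
    by rewrite mulr1 rmorphM.
  rewrite sum_fword_eq mem_fockwords /= xF andbT.
  have [iF|iNF] := boolP (i \in F); last first.
    rewrite andbF /u /= TF// !mul0mx mulmx0.
    by case: ifP; rewrite scaler0.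
  rewrite andbT; case: ltnP => [xm'|_]; last by rewrite scaler0.
  rewrite findexK ?mem_fockwords /= ?xm' ?iF// exprS mulrA divff ?gt_eqF//.
  by rewrite mul1r.
transitivity (X *m (f _ (fock_point F m (half01 R)) *m delta_mx (findex F m [::]) (ord0 : 'I_1))).
  by rewrite mulmxA -XI -mulmxA -colE X0.
rewrite XE -sum_fword; apply: eq_bigr => x _.
rewrite -colE mxE -[x in LHS]fwordK fock_value ?mem_fword// fwordK.
by rewrite scalerA mulrAC -rmorphM/= -exprMn divff ?gt_eqF// expr1n mul1r.
Qed.

End WeightedShift.

(** * Power series and polynomial approximation *)

Section Approximation.
Variables (R : realType) (L : choiceType).
Implicit Types (F : {fset L}) (w : seq L) (m n : nat) (f : ncmap R L).

Lemma exp_small (rho d : R) : 0 <= rho < 1 -> 0 < d -> exists m, rho ^+ m < d.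
Proof.
move=> /andP[rho0 rho1] d0.
have /cvgrPdist_lt/(_ _ d0)[m _ /(_ m (leqnn m))] :
    (fun n => rho ^+ n) @ \oo --> (0 : R).
  by apply: cvg_expr; rewrite ger0_norm.
by rewrite /= sub0r normrN ger0_norm ?exprn_ge0// => ?; exists m.
Qed.

(** Dilation by [rho] is the compression of the tensor product with the cyclic
    shift of weight [rho ^ m.+1], which is within [rho ^ m.+1] of the nilpotent
    shift; the value of [f] at the latter is the truncated power series. *)
Lemma dilation_expansion f (rho e : R) : Ad f -> 0 <= rho < 1 -> 0 < e ->
  exists m, forall F n (T : ncball R L n) (rho1 : 0 <= rho <= 1),
    (forall i, i \notin F -> sval T i = 0) ->
    opbound (f n (scale_point T rho1) -
      \sum_(w <- fockwords F m) ((rho ^+ size w)%:C * coef f w) *: wprod (sval T) w) e.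
Proof.
move=> fA rho01 e0; have /andP[rho0 rho1] := rho01.
have d0 : 0 < 1 - rho by rewrite subr_gt0.
have [d dgt0 fd] := Ad_unif fA (mulr_gt0 e0 d0).
have [m mE] := exp_small rho01 dgt0.
exists m => F n T rhole1 TF.
have [r r1 Tr] := ncball_rowbound T; have /andP[r0 r1'] := r1.
pose k := rho ^+ m.+1.
have k01 : 0 <= k <= 1 by rewrite exprn_ge0//= exprn_ile1// ltW.
have kd : k < d by apply: le_lt_trans mE; rewrite /k exprS ler_piMl ?exprn_ge0// ltW.
have z01 : 0 <= (0 : R) <= 1 by rewrite lexx ler01.
pose Y := wshift_point m k01 r1 Tr; pose Z := wshift_point m z01 r1 Tr.
have YZ : opbound (f _ Y - f _ Z) (e * (1 - rho)).
  apply: (fd _ _ _ (k * r)).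
    have /andP[k0 k1] := k01.
    by rewrite mulr_ge0//= (le_lt_trans _ kd)// ler_piMr// ltW.
  rewrite (_ : (fun i => _) =
      wshift (fun q : 'I_m.+1 => if q == 0 :> nat then k - 0 else 0) (sval T)).
    apply: (@rowbound_wshift _ _ m.+1 n.+1 _ _ k r _ Tr) => q; rewrite subr0; have /andP[k0 _] := k01.
    by case: ifP => _; rewrite ?k0 lexx.
  by apply/funext => i; rewrite -wshiftB.
have XY : f _ (scale_point T rhole1) *m georow m.+1 n.+1 rho =
    georow m.+1 n.+1 rho *m f _ Y.
  apply: (nc_intertwine (U := Y) (Ad_nc fA)) => i.
  by rewrite /= georow_wshift.
move=> v; set q := \sum_(w <- _) _.
have -> : (f n (scale_point T rhole1) - q) *m v =
    georow m.+1 n.+1 rho *m ((f _ Y - f _ Z) *m (blockinj R n.+1 (ord0 : 'I_m.+1) *m v)).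
  rewrite [in RHS]mulmxBl mulmxBr (wshift_value m z01 r1 Tr v (Ad_nc fA) TF).
  rewrite mulmxBl; congr (_ - _).
    rewrite [RHS]mulmxA -XY -[RHS]mulmxA; congr (_ *m _).
    by rewrite (@georow_blockinj R m.+1 n.+1 1) expr0 scale1r.
  rewrite mulmx_suml mulmx_sumr; apply: eq_big_seq => w.
  rewrite mem_fockwords => /andP[wm _].
  rewrite -scalemxAr -scalemxAl mulrC -scalerA; congr (_ *: _).
  by rewrite (@georow_blockinj R m.+1 n.+1 1) inordK.
apply: le_trans (georow_opbound rho01 _) _.
rewrite ler_pdivrMl// mulrA [(1 - rho) * e]mulrC; apply: le_trans (YZ _) _.
apply: ler_wpM2l; first by rewrite mulr_ge0// ltW.
by have := @opbound_blockinj R m.+1 n.+1 ord0 v; rewrite mul1r.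
Qed.

(** The first letter is absorbed by the row contraction [T] itself, the others by
    induction on the length. *)
Lemma words_contraction n F r (T : L -> 'M[R[i]]_n) (v : seq L -> 'cV[R[i]]_n) :
  rowbound T 1 ->
  l2norm (\sum_(w <- words F r) wprod T w *m v w) ^+ 2 <=
  \sum_(w <- words F r) l2norm (v w) ^+ 2.
Proof.
move=> T1; elim: r v => [|r IH] v; first by rewrite !big_seq1 mul1mx.
rewrite /= !big_flatten !big_map.
under eq_bigr do rewrite big_map.
under [in leRHS]eq_bigr do rewrite big_map.
have := T1 F (fun i => \sum_(w <- words F r) wprod T w *m v (i :: w)).
rewrite expr1n mul1r => h; apply: le_trans (_ : _ <= _) (le_trans h _); last first.
  by apply: ler_sum => i _; exact: IH.
rewrite le_eqVlt; apply/orP; left; apply/eqP; congr (l2norm _ ^+ 2).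
by apply: eq_bigr => i _; rewrite mulmx_sumr; apply: eq_bigr => w _; rewrite mulmxA.
Qed.

Lemma words_sum_opbound n F r (T : L -> 'M[R[i]]_n) (a : seq L -> R[i]) :
  rowbound T 1 ->
  opbound (\sum_(w <- words F r) a w *: wprod T w)
    (Num.sqrt (\sum_(w <- words F r) normc (a w) ^+ 2)).
Proof.
move=> T1 v; apply: ler_l2sqr; first by rewrite mulr_ge0// sqrtr_ge0.
have a0 : 0 <= \sum_(w <- words F r) normc (a w) ^+ 2.
  by apply: sumr_ge0 => w _; exact: sqr_ge0.
rewrite exprMn (sqr_sqrtr a0) mulr_suml mulmx_suml.
under eq_bigr do rewrite -scalemxAl scalemxAr.
apply: le_trans (words_contraction _ _ _ T1) _.
by apply: ler_sum => w _; rewrite l2normZ exprMn.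
Qed.

(** Take for [s0] a finite family whose sum nearly attains the supremum. *)
Lemma small_tail (X : choiceType) (a : X -> R) (M e : R) :
  (forall x, 0 <= a x) -> (forall s : seq X, uniq s -> \sum_(x <- s) a x <= M) ->
  0 < e ->
  exists2 s0 : seq X, uniq s0 & forall s, uniq s ->
    {in s, forall x, x \notin s0} -> \sum_(x <- s) a x <= e.
Proof.
move=> a0 aM e0.
pose S := [set y | exists2 s : seq X, uniq s & y = \sum_(x <- s) a x].
have hS : has_sup S.
  split; first by exists 0, [::]; rewrite ?big_nil.
  by exists M => _ [s us ->]; exact: aM.
have [_ [s0 us0 ->] hs0] := sup_adherent e0 hS.
exists s0 => // s us ss0; have : \sum_(x <- s0 ++ s) a x <= sup S.
  apply: sup_ubound; first by case: hS.
  exists (s0 ++ s) => //; rewrite cat_uniq us0 us andbT.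
  by apply/hasPn => x /ss0.
rewrite big_cat /= -lerBrDl => /le_trans; apply.
by rewrite lerBlDr -lerBlDl ltW.
Qed.

(** Tested on the conjugates of the [a]-th rows of the matrices [T i], the row
    operator has for [a]-th coordinate the sum of the squared norms of these
    rows. *)
Lemma rowbound_hs n (T : L -> 'M[R[i]]_n) r (s : {fset L}) : 0 <= r -> rowbound T r ->
  \sum_(i <- s) \sum_(a < n) \sum_(b < n) normc (T i a b) ^+ 2 <= n%:R * r ^+ 2.
Proof.
move=> r0 Tr; rewrite exchange_big /=.
have row_le a : \sum_(i <- s) \sum_(b < n) normc (T i a b) ^+ 2 <= r ^+ 2.
  set q := \sum_(i <- s) _.
  have q0 : 0 <= q by do 2![apply: sumr_ge0 => ? _]; exact: sqr_ge0.
  pose v i : 'cV[R[i]]_n := \col_b (T i a b)^*.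
  have vE i : l2norm (v i) ^+ 2 = \sum_(b < n) normc (T i a b) ^+ 2.
    rewrite l2norm_sqr; apply: eq_bigr => b _; rewrite mxE.
    by case: (T i a b) => x y /=; rewrite sqrrN.
  have := Tr s v; rewrite (eq_bigr _ (fun i _ => vE i)) -/q => qr.
  have [->|qN0] := eqVneq q 0; first exact: sqr_ge0.
  have qp : 0 < q by rewrite lt_def qN0.
  rewrite -(ler_pM2r qp); apply: le_trans qr; rewrite -expr2.
  have := normc_le_l2norm (\sum_(i <- s) T i *m v i) a.
  have -> : (\sum_(i <- s) T i *m v i) a ord0 = q%:C.
    rewrite summxE rmorph_sum /=; apply: eq_bigr => i _.
    rewrite mxE rmorph_sum /=; apply: eq_bigr => b _; rewrite mxE.
    rewrite -normCK normcE rmorphXn //.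
  rewrite normcR ger0_norm// => h.
  by rewrite ler_pXn2r ?nnegrE.
apply: le_trans (ler_sum _ (fun a _ => row_le a)) _.
by rewrite sumr_const card_ord mulr_natl.
Qed.

Lemma rowbound_of_hs n (T : L -> 'M[R[i]]_n) (e : R) : 0 <= e ->
  (forall s : {fset L},
     \sum_(i <- s) \sum_(a < n) \sum_(b < n) normc (T i a b) ^+ 2 <= e ^+ 2) ->
  rowbound T e.
Proof.
move=> e0 Te s v.
set h := fun i => \sum_(a < n) \sum_(b < n) normc (T i a b) ^+ 2.
have h0 i : 0 <= h i by do 2![apply: sumr_ge0 => ? _]; exact: sqr_ge0.
apply: (@le_trans _ _ ((\sum_(i <- s) h i) * \sum_(i <- s) l2norm (v i) ^+ 2)).
  rewrite [\sum_(i <- s) h i](eq_bigr (fun i => Num.sqrt (h i) ^+ 2)); last first.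
    by move=> i _; rewrite sqr_sqrtr.
  apply: le_trans (cauchy_schwarz_sum _ _ _ _).
  rewrite ler_pXn2r ?nnegrE//; last first.
    by apply: sumr_ge0 => i _; rewrite mulr_ge0// sqrtr_ge0.
  apply: le_trans (ler_l2norm_sum _ _ _) _; apply: ler_sum => i _.
  exact: opbound_hs.
apply: ler_wpM2r; last exact: Te.
by apply: sumr_ge0 => i _; exact: sqr_ge0.
Qed.

(** In finite matrix size the squared Hilbert-Schmidt norms of the [T i] are
    summable, and their tail bounds the norm of the discarded variables. *)
Lemma restr_approx n (T : ncball R L n) (d : R) : 0 < d ->
  exists F0 : {fset L}, forall F, {subset F0 <= F} ->
    rowbound (fun i => sval T i - restr F (sval T) i) d.
Proof.
move=> d0; have [r /andP[r0 r1] Tr] := ncball_rowbound T.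
pose h i := \sum_(a < n.+1) \sum_(b < n.+1) normc (sval T i a b) ^+ 2.
have h0 i : 0 <= h i by do 2![apply: sumr_ge0 => ? _]; exact: sqr_ge0.
have hM (s : seq L) : uniq s -> \sum_(i <- s) h i <= n.+1%:R * r ^+ 2.
  move=> us; rewrite (perm_big (seq_fset tt s)).
    exact: (rowbound_hs (seq_fset tt s) r0 Tr).
  by apply: uniq_perm => // i; rewrite seq_fsetE.
have [s0 us0 s0P] := small_tail h0 hM (exprn_gt0 2 d0).
exists (seq_fset tt s0) => F sF.
apply: rowbound_of_hs (ltW d0) _ => s.
apply: le_trans (s0P [seq i <- s | i \notin s0] _ _); last 2 first.
- by rewrite filter_uniq// fset_uniq.
- by move=> i; rewrite mem_filter => /andP[].
rewrite big_filter [leRHS]big_mkcond; apply: ler_sum => i _ /=; rewrite /restr.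
have [is0|_] := boolP (i \in s0) => /=.
  rewrite sF ?seq_fsetE// big1// => a _; rewrite big1// => b _.
  by rewrite subrr mxE normc0 expr0n.
case: ifP => _; last by rewrite subr0.
rewrite big1 ?h0// => a _; rewrite big1// => b _.
by rewrite subrr mxE normc0 expr0n.
Qed.

End Approximation.

Section PolynomialApproximation.
Variables (R : realType) (L : choiceType).
Implicit Types (F : {fset L}) (w : seq L) (m n : nat) (f : ncmap R L).

Lemma wprod_restr n F (T : L -> 'M[R[i]]_n) w : all (mem F) w ->
  wprod (restr F T) w = wprod T w.
Proof.
elim: w => //= i w IH /andP[iF wF]; rewrite IH// /restr.
by congr (_ *m _); rewrite (_ : i \in F).
Qed.

(** The weighted coefficients of [f] form the column of the vacuum vector in the
    value of [f] at a dilate of the creation operators. *)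
Lemma coef_l2_bound f (rho M : R) F m : Ad f -> 0 < rho < 1 -> 0 <= M ->
  (forall n (T : ncball R L n), opbound (f n T) M) ->
  \sum_(w <- fockwords F m) normc ((rho ^+ size w)%:C * coef f w) ^+ 2 <= M ^+ 2.
Proof.
move=> fA /andP[rho0 rho1] M0 fM.
have rho01 : 0 <= rho < 1 by rewrite ltW.
pose e : 'cV[R[i]]_(fockdim F m).+1 := delta_mx (findex F m [::]) ord0.
have e1 : l2norm e = 1.
  rewrite /l2norm (bigD1 (findex F m [::]))//= mxE !eqxx big1 => [|x x0].
    by rewrite normc1 expr1n addr0 sqrtr1.
  by rewrite mxE (negPf x0) normc0 expr0n.
have := fM _ (fock_point F m rho01) e; rewrite e1 mulr1 => h.
have : l2norm (f _ (fock_point F m rho01) *m e) ^+ 2 <= M ^+ 2.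
  by rewrite ler_pXn2r ?nnegrE.
apply: le_trans; rewrite l2norm_sqr -sum_fword le_eqVlt; apply/orP; left.
apply/eqP/eq_bigr => x _; rewrite -colE mxE -[x in RHS]fwordK.
by rewrite fock_value ?mem_fword//; exact: Ad_nc.
Qed.

Definition restr_point n F (T : ncball R L n) : ncball R L n :=
  let: exist2 r r1 Tr := cid2 (ncball_rowbound T) in
  ball_point r1 (rowbound_restr F Tr).

Lemma restr_pointE n F (T : ncball R L n) : sval (restr_point F T) = restr F (sval T).
Proof. by rewrite /restr_point; case: cid2. Qed.

(** The set [F0] collects the letters of finitely many words that carry all but a
    small part of the square sum of the weighted coefficients; whatever the
    letters of [T], the words outside [F] then contribute little. *)
Lemma poly_approx f (e : R) : Ad f -> 0 < e ->
  exists (rho : R) m (F0 : {fset L}), 0 < rho < 1 /\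
    forall F, {subset F0 <= F} -> forall n (T : ncball R L n),
    opbound (f n T -
      \sum_(w <- fockwords F m) ((rho ^+ size w)%:C * coef f w) *: wprod (sval T) w) e.
Proof.
move=> fA e0; pose e4 := e / 4; have e40 : 0 < e4 by rewrite divr_gt0.
have [d d0 fd] := Ad_unif fA e40.
pose mu : R := Num.min (d / 2) 2^-1.
have mu0 : 0 < mu by rewrite lt_min divr_gt0//= invr_gt0 ltr0n.
have mud : mu < d.
  by rewrite gt_min ltr_pdivrMr// mulr_natr mulr2n ltrDl d0.
have mu1 : mu < 1.
  by rewrite gt_min; apply/orP; right; rewrite invf_lt1 ?ltr1n.
pose rho := 1 - mu.
have rho01 : 0 < rho < 1 by rewrite /rho subr_gt0 mu1 ltrBlDr ltrDl.
have /andP[rho0 rho1] := rho01.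
have rho01' : 0 <= rho < 1 by rewrite ltW.
have rhole : 0 <= rho <= 1 by rewrite !ltW.
have [m fm] := dilation_expansion fA rho01' e40.
have [M M0 fM] := Ad_bounded fA.
pose c w := (rho ^+ size w)%:C * coef f w.
pose a w := if (size w <= m)%N then normc (c w) ^+ 2 else 0.
have a0 w : 0 <= a w by rewrite /a; case: ifP => // _; exact: sqr_ge0.
have aM (s : seq (seq L)) : uniq s -> \sum_(w <- s) a w <= M ^+ 2.
  move=> us; pose F := seq_fset tt (flatten s).
  rewrite /a -big_mkcond -big_filter.
  apply: le_trans (coef_l2_bound F m fA rho01 M0 fM).
  apply: ler_sum_subset => [||w]; [exact: filter_uniq|move=> w|exact: sqr_ge0].
  rewrite mem_filter mem_fockwords => /andP[-> ws]; apply/allP => i iw.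
  by rewrite /= seq_fsetE; apply/flattenP; exists w.
(* each of the [m.+1] degrees is allowed an error of [e4 / m.+1] *)
pose e' := e4 / m.+1%:R.
have e'0 : 0 < e' by rewrite divr_gt0.
have [s0 us0 s0P] := small_tail a0 aM (exprn_gt0 2 e'0).
exists rho, m, (seq_fset tt (flatten s0)); split=> // F sF n T.
pose q F' (U : L -> 'M[R[i]]_n.+1) := \sum_(w <- fockwords F' m) c w *: wprod U w.
have d2 : 0 < d / 2 by rewrite divr_gt0.
have [F1 F1P] := restr_approx T d2.
pose F' := (F `|` F1)%fset.
have FF' : {subset F <= F'} by move=> i iF; rewrite in_fsetU iF.
have F1F' : {subset F1 <= F'} by move=> i iF; rewrite in_fsetU iF orbT.
pose T' := restr_point F' T.
have T'E := restr_pointE F' T.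
have [r /andP[r0 r1] T'r] := ncball_rowbound T'.
(* [f(T)] is compared to [f(T')], then to [f(rho T')], then to the truncated
   series over the letters of [T'], and finally to the one over [F], which takes
   the same value at [T'] and at [T] *)
have step1 : opbound (f n T - f n T') e4.
  apply: (fd _ _ _ (d / 2)); last by rewrite T'E; exact: F1P.
  by rewrite (ltW d2)/= ltr_pdivrMr// mulr_natr mulr2n ltrDl.
have step2 : opbound (f n T' - f n (scale_point T' rhole)) e4.
  apply: (fd _ _ _ mu); first by rewrite ltW.
  have -> : (fun i => sval T' i - sval (scale_point T' rhole) i) =
      (fun i => mu%:C *: sval T' i).
    by apply/funext => i /=; rewrite /rho rmorphB/= scalerBl scale1r subKr.
  apply: rowbound_le (rowboundZ _ T'r).
  have mu0' := ltW mu0.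
  by rewrite normcR ger0_norm// mulr_ge0//= ler_piMr// ltW.
have step3 : opbound (f n (scale_point T' rhole) - q F' (sval T')) e4.
  apply: fm => i iF; rewrite T'E /restr; by rewrite (negPf iF).
have step4 : opbound (q F' (sval T') - q F (sval T')) e4.
  pose b w := if w \in fockwords F m then 0 else c w.
  have -> : q F' (sval T') - q F (sval T') =
      \sum_(w <- fockwords F' m) b w *: wprod (sval T') w.
    rewrite /q [X in _ - X](perm_big [seq w <- fockwords F' m | w \in fockwords F m]); last first.
      apply: uniq_perm; rewrite ?filter_uniq ?fockwords_uniq// => w.
      rewrite mem_filter andb_idr// !mem_fockwords => /andP[-> wF].
      apply/allP => i iw.
      by apply: FF'; exact: (allP wF).
    rewrite big_filter [X in _ - X]big_mkcond -sumrB; apply: eq_bigr => w _.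
    by rewrite /b; case: ifP; rewrite ?subrr ?scale0r// subr0.
  rewrite big_fockwords.
  apply: (@opbound_le _ _ _ _ (\sum_(r < m.+1) e')); last first.
    apply: opbound_sum => k _.
    have T'1 : rowbound (sval T') 1.
      by apply: rowbound_le T'r; rewrite r0 ltW.
    apply: opbound_le (words_sum_opbound F' k b T'1).
    rewrite -[leRHS](ger0_norm (ltW e'0)) -sqrtr_sqr ler_sqrt ?sqr_ge0//.
    apply: le_trans (s0P [seq w <- words F' k | w \notin fockwords F m] _ _).
    - rewrite big_filter [leRHS]big_mkcond le_eqVlt; apply/orP; left.
      apply/eqP/eq_big_seq => w.
      rewrite mem_words /b /a => /andP[/eqP -> _]; rewrite -ltnS ltn_ord.
      by case: (w \in fockwords F m) => //; rewrite normc0 expr0n.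
    - by rewrite filter_uniq// words_uniq.
    - move=> w; rewrite mem_filter mem_words mem_fockwords.
      move=> /and3P[+ /eqP wk _]; apply: contraNN => ws0.
      rewrite wk -ltnS ltn_ord /=; apply/allP => i iw /=; apply: sF.
      by rewrite seq_fsetE; apply/flattenP; exists w.
  by rewrite sumr_const card_ord -[e' *+ _]mulr_natr /e' divfK ?pnatr_eq0// lexx.
have step5 : q F (sval T') = q F (sval T).
  rewrite /q; apply: eq_big_seq => w; rewrite mem_fockwords => /andP[_ wF].
  by rewrite T'E wprod_restr//; apply: sub_all wF => i; exact: FF'.
have := opboundD step1 (opboundD step2 (opboundD step3 step4)).
rewrite step5 !addrA !subrK; apply: opbound_le.
rewrite /e4; lra.
Qed.

End PolynomialApproximation.

(** * Nilpotent points of the zero set *)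

Section LinearProjection.
Variables (K : fieldType) (n : nat) (P : 'cV[K]_n -> Prop).
Hypotheses (P0 : P 0) (PZD : forall a u v, P u -> P v -> P (a *: u + v)).

Lemma lincomb_closed m (A : 'M[K]_(m, n)) (u : 'rV[K]_n) :
  (forall i, P (row i A)^T) -> (u <= A)%MS -> P u^T.
Proof.
move=> PA /submxP[D ->]; rewrite mulmx_sum_row.
elim/big_rec : _ => [|i v _ Pv]; first by rewrite trmx0.
rewrite linearD linearZ; apply: PZD; [exact: PA|exact: Pv].
Qed.

(** A matrix of maximal rank among those whose rows satisfy [P]. *)
Lemma subspace_mx :
  exists U : 'M[K]_n, forall u : 'rV[K]_n, P u^T <-> (u <= U)%MS.
Proof.
pose Q r := `[< exists2 U : 'M[K]_n, (forall i, P (row i U)^T) & \rank U = r >].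
have exQ : exists r, Q r.
  exists 0%N; apply/asboolP; exists 0; last exact: mxrank0.
  by move=> i; rewrite row0 trmx0.
have ubQ r : Q r -> (r <= n)%N.
  by move=> /asboolP[U _ <-]; exact: rank_leq_row.
case: (ex_maxnP exQ ubQ) => r /asboolP[U PU Ur] max_r.
exists U => u; split=> [Pu|]; last exact: lincomb_closed.
have PV i : P (row i (U + u)%MS)^T.
  have : (row i (U + u)%MS <= col_mx U u)%MS.
    by rewrite -addsmxE row_sub.
  apply: lincomb_closed => j; case: (split_ordP j) => k ->.
    by rewrite rowKu.
  by rewrite rowKd row_id.
have rV : (\rank (U + u)%MS <= \rank U)%N.
  by rewrite Ur; apply: max_r; apply/asboolP; exists (U + u)%MS; [exact: PV|].
have : (U + u <= U)%MS.
  have [_] := mxrank_leqif_sup (addsmxSl U u).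
  by rewrite eqn_leq rV mxrankS ?addsmxSl// => <-.
by rewrite addsmx_sub => /andP[].
Qed.

(** The projection along the subspace [P] onto some complement: it represents the
    quotient by [P] inside the same space, and so in the same matrix size. *)
Lemma linear_projection : exists E : 'M[K]_n,
  (forall u, P (u - E *m u)) /\ (forall u, P u -> E *m u = 0).
Proof.
have [U UP] := subspace_mx; pose Q := cokermx U.
exists (Q *m pinvmx Q)^T; split=> u.
  rewrite -[_ - _]trmxK; apply/UP; rewrite submxE -/Q.
  rewrite linearB /= trmx_mul trmxK mulmxBl -(mulmxA _ _ Q).
  by rewrite mulmxKpV// subrr.
rewrite -{1}[u]trmxK => /UP; rewrite submxE -/Q => /eqP uQ.
by apply: trmx_inj; rewrite trmx_mul trmxK mulmxA uQ mul0mx trmx0.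
Qed.

End LinearProjection.

Section Ideals.
Variables (R : realType) (L : choiceType).
Implicit Types (F : {fset L}) (w : seq L) (m n j k : nat) (f g : ncmap R L).

Lemma Ad_1 : Ad (1 : ncmap R L).
Proof.
apply: Ad_intro => [|e e0].
  split=> [m n T U W _|n T U S SU _]; rewrite !ncmap1E.
    by rewrite -(@scalar_mx_block _ m.+1 n.+1).
  by rewrite mulmx1 mulVmx.
exists 1 => // n T U r _ _ v; rewrite subrr mul0mx l2norm0 mulr_ge0//.
exact: ltW.
Qed.

Lemma Ad_monomial w : Ad (@monomial R L w).
Proof.
rewrite /monomial; elim/big_rec : _ => [|i f _ fA]; first exact: Ad_1.
exact/Ad_mul/fA/Ad_zcoord.
Qed.

Lemma Ad_sum (I : Type) (r : seq I) (Q : pred I) (h : I -> ncmap R L) :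
  (forall i, Q i -> Ad (h i)) -> Ad (\sum_(i <- r | Q i) h i).
Proof.
by move=> hA; elim/big_rec : _ => [|i f Qi fA]; [exact: Ad_0|exact/Ad_add/fA/hA].
Qed.

Lemma ncmap_scaleAl a f g : a *: (f * g) = a *: f * g.
Proof. by apply: ncmapP => n T; rewrite ncmapZE !ncmapME scalemxAl. Qed.

Lemma ncmap_scaleAr a f g : a *: (f * g) = f * (a *: g).
Proof. by apply: ncmapP => n T; rewrite ncmapZE !ncmapME scalemxAr. Qed.

Lemma monomial_cat w w' :
  @monomial R L (w ++ w') = @monomial R L w * @monomial R L w'.
Proof. by rewrite /monomial big_cat. Qed.

Lemma wprod_creationE F m w x y :
  wprod (creation R F m) w x y = (fword x == w ++ fword y)%:R.
Proof.
elim: w x => [|i w IH] x.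
  by rewrite /= mxE; congr (_%:R); rewrite (inj_eq (@fword_inj _ F m)).
rewrite wprod_cons creationE; have := mem_fword x.
case: (fword x) => [|j u] // /fockwords_cons[_ uF].
by rewrite /= eqseq_cons IH findexK//; case: eqP.
Qed.

(** The vector [a] stands for a polynomial of degree at most [m], given by its
    coefficients in the basis of words. *)
Definition component F m (a : 'cV[R[i]]_(fockdim F m).+1) j : ncmap R L :=
  \sum_(x < (fockdim F m).+1 | size (fword x) == j)
    a x ord0 *: @monomial R L (fword x).

Lemma component0 F m j : component (0 : 'cV[R[i]]_(fockdim F m).+1) j = 0.
Proof. by rewrite /component big1// => x _; rewrite mxE scale0r. Qed.

Lemma componentZD F m c (a b : 'cV[R[i]]_(fockdim F m).+1) j :
  component (c *: a + b) j = c *: component a j + component b j.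
Proof.
rewrite /component scaler_sumr -big_split /=.
by apply: eq_bigr => x _; rewrite !mxE scalerDl scalerA.
Qed.

Lemma component_coef f F m t (t1 : 0 <= t < 1) r : nc_function f -> 0 < t ->
  (r <= m)%N ->
  component (col (findex F m [::]) (f _ (fock_point F m t1))) r =
  (t ^+ r)%:C *: \sum_(w <- words F r) coef f w *: @monomial R L w.
Proof.
move=> fnc t0 rm; rewrite /component scaler_sumr.
under eq_bigr => x /eqP xr.
  rewrite mxE -[x in f _ _ x _]fwordK fock_value ?mem_fword// xr -scalerA.
  over.
rewrite big_mkcond (sum_fword F m (fun w => if size w == r then
  (t ^+ r)%:C *: (coef f w *: @monomial R L w) else 0)).
rewrite -big_mkcond -big_filter; apply: perm_big; apply: uniq_perm.
- by rewrite filter_uniq// fockwords_uniq.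
- exact: words_uniq.
move=> w; rewrite mem_filter mem_words mem_fockwords.
by case: eqP => // ->; rewrite rm.
Qed.

(** Creation operators act on coefficient vectors as multiplication of
    polynomials, truncated above degree [m]. *)
Lemma component_poly F m k (s : seq (seq L)) (c : seq L -> R[i])
    (a : 'cV[R[i]]_(fockdim F m).+1) j :
  (forall w, w \in s -> size w = k /\ {subset w <= F}) ->
  component ((\sum_(w <- s) c w *: wprod (creation R F m) w) *m a) j =
  if (k <= j <= m)%N then
    (\sum_(w <- s) c w *: @monomial R L w) * component a (j - k)%N else 0.
Proof.
move=> sP; rewrite /component.
have term w (ws : w \in s) :
    \sum_(x < (fockdim F m).+1 | size (fword x) == j)
      (wprod (creation R F m) w *m a) x ord0 *: @monomial R L (fword x) =
    if (k <= j <= m)%N then @monomial R L w *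
      \sum_(y < (fockdim F m).+1 | size (fword y) == (j - k)%N)
        a y ord0 *: @monomial R L (fword y) else 0.
  have [wk wF] := sP _ ws.
  transitivity (\sum_(y < (fockdim F m).+1)
     \sum_(x < (fockdim F m).+1 | fword x == w ++ fword y)
       if size (fword x) == j then a y ord0 *: @monomial R L (fword x) else 0).
    rewrite big_mkcond; under [RHS]eq_bigr do rewrite big_mkcond.
    rewrite exchange_big /=; apply: eq_bigr => x _.
    case: eqP => _; last by rewrite big1// => y _; case: ifP.
    rewrite mxE scaler_suml; apply: eq_bigr => y _.
    by rewrite wprod_creationE; case: ifP => _; rewrite ?mul1r// mul0r scale0r.
  rewrite (eq_bigr (fun y => if (k <= j <= m)%N && (size (fword y) == j - k)%N
      then @monomial R L w * (a y ord0 *: @monomial R L (fword y)) else 0)).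
    case: ifP => _ /=; last by rewrite big1.
    by rewrite -big_mkcond mulr_sumr.
  move=> y _; rewrite sum_fword_eq mem_fockwords all_cat size_cat wk.
  have -> : all (mem F) w by apply/allP => i /wF.
  have := mem_fword y; rewrite mem_fockwords => /andP[ym ->]; rewrite !andbT.
  case: ifPn => [wy|wy].
    rewrite findexK; last first.
      rewrite mem_fockwords all_cat size_cat wk wy.
      have -> : all (mem F) w by apply/allP => i /wF.
      by have := mem_fword y; rewrite mem_fockwords => /andP[_ ->].
    rewrite size_cat wk monomial_cat.
    have -> : (k + size (fword y) == j)%N =
        (k <= j <= m)%N && (size (fword y) == j - k)%N.
      apply/eqP/andP => [<-|[/andP[kj _] /eqP ->]]; last by rewrite subnKC.
      by rewrite addKn leq_addr wy.
    by case: ifP => // _; rewrite -ncmap_scaleAr.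
  case: ifPn => // /andP[/andP[kj jm] /eqP yE].
  by move: wy; rewrite yE subnKC// jm.
rewrite mulmx_suml.
under eq_bigr do rewrite summxE scaler_suml.
rewrite exchange_big /=.
rewrite (eq_big_seq (fun w => c w *: if (k <= j <= m)%N then @monomial R L w *
      \sum_(y < (fockdim F m).+1 | size (fword y) == (j - k)%N)
        a y ord0 *: @monomial R L (fword y) else 0)); last first.
  move=> w ws; rewrite -term// scaler_sumr; apply: eq_bigr => x _.
  by rewrite -scalemxAl mxE scalerA.
case: ifP => _; last by rewrite big1// => w _; rewrite scaler0.
by rewrite mulr_suml; apply: eq_bigr => w _; rewrite -ncmap_scaleAl.
Qed.

End Ideals.

Section Nullstellensatz.
Variables (R : realType) (L : choiceType).
Implicit Types (F : {fset L}) (w : seq L) (m n j k : nat) (f g : ncmap R L).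
Variables (J G : set (ncmap R L)).
Hypotheses (Jideal : closed_ideal J) (JG : generated_by J G) (J1 : ~ J 1).

Lemma mulmx_cV_eq0 m n (A : 'M[R[i]]_(m, n)) :
  (forall u : 'cV[R[i]]_n, A *m u = 0) -> A = 0.
Proof.
move=> A0; apply: opbound_small0 => e e0 u.
by rewrite A0 l2norm0 mulr_ge0// ltW.
Qed.

Lemma ideal_sum (I : eqType) (r : seq I) (Q : pred I) (h : I -> ncmap R L) :
  (forall i, Q i -> J (h i)) -> J (\sum_(i <- r | Q i) h i).
Proof.
have [[_ J0 JD _ _] _] := Jideal.
by move=> Jh; elim/big_rec : _ => // i f Qi; exact/JD/Jh.
Qed.

(** The condition says that the kernel of [E] is invariant under the [C i] when
    [E] is idempotent: products of compressions are then compressions of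
    products. *)
Lemma wprod_compression n (E : 'M[R[i]]_n.+1) (C : L -> 'M[R[i]]_n.+1) (t : R) w :
  (forall i, E *m C i *m E = E *m C i) -> w != [::] ->
  wprod (fun i => t%:C *: (E *m C i)) w = (t ^+ size w)%:C *: (E *m wprod C w).
Proof.
move=> ECE; elim: w => // i [_ _|j w IH _]; first by rewrite /= !mulmx1.
rewrite wprod_cons IH// -scalemxAl -scalemxAr scalerA -rmorphM -exprS.
by rewrite mulmxA ECE -mulmxA.
Qed.

Lemma generator_in_ideal g : G g -> J g.
Proof. by rewrite JG => Gg M [_]; exact. Qed.

(** The polynomials over [F] of degree at most [m] modulo those whose
    homogeneous components lie in [J] carry the multiplications by the
    variables. Realized on a complement, as the compressions [E L_i] of the
    creation operators, and scaled into the ball, these give a point of the zero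
    set of [J]; there the value of [f] at the vacuum is its truncated power
    series modulo [J]. *)
Lemma homogeneous_part_in_ideal f F m r :
  (forall g, G g -> homogeneous_poly_in F g \/
     forall n (T : ncball R L n), (forall i, i \notin F -> sval T i = 0) -> g n T = 0) ->
  Ad f -> (forall n (T : ncball R L n), ncV J T -> f n T = 0) -> (r <= m)%N ->
  J (\sum_(w <- words F r) coef f w *: @monomial R L w).
Proof.
move=> GF fA fV rm; have [[JA J0 JD JZ JM] _] := Jideal.
pose P (a : 'cV[R[i]]_(fockdim F m).+1) := forall j, J (component a j).
have P0 : P 0 by move=> j; rewrite component0.
have PZD a u v : P u -> P v -> P (a *: u + v).
  by move=> Pu Pv j; rewrite componentZD; apply/JD/Pv/JZ.
have [E [PE EP]] := linear_projection P0 PZD.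
pose C i := creation R F m i.
have PC i u : P u -> P (C i *m u).
  move=> Pu; have [iF|iNF] := boolP (i \in F); last first.
    by rewrite /C creation_notin// mul0mx.
  move=> j; have := @component_poly R L F m 1 [:: [:: i]] (fun=> 1) u j.
  rewrite !big_seq1 !scale1r /wprod /= mulmx1 => -> => [|w].
    case: ifP => // _; apply: (JM _ _ _ (Pu _)).1.
    exact: Ad_monomial.
  by rewrite inE => /eqP ->; split=> // k; rewrite inE => /eqP ->.
have ECE i : E *m C i *m E = E *m C i.
  apply/eqP; rewrite -subr_eq0 -opprB oppr_eq0; apply/eqP/mulmx_cV_eq0 => u.
  rewrite -{1}[E *m C i]mulmx1 -mulmxBr -!mulmxA.
  apply: EP; apply: PC; rewrite mulmxBl mul1mx; exact: PE.
have [c c0 Ec] : exists2 c : R, 0 <= c & opbound E c.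
  by eexists; last exact: opbound_hs; exact: sqrtr_ge0.
(* small enough for both [t L] and [t E L] to lie in the ball *)
pose t : R := (2 * (c + 1))^-1.
have c1 : 0 < c + 1 by rewrite ltr_wpDl.
have t0 : 0 < t by rewrite invr_gt0 mulr_gt0.
have t1 : 0 <= t < 1.
  by rewrite (ltW t0) invf_lt1 ?mulr_gt0//; lra.
have tc1 : 0 <= t * c < 1.
  rewrite mulr_ge0 ?(ltW t0)//= /t mulrC ltr_pdivrMr ?mulr_gt0//.
  by lra.
have Vr : rowbound (fun i => t%:C *: (E *m C i)) (t * c).
  have := rowboundZ t%:C (rowbound_mull c0 Ec (@rowbound_creation R L F m)).
  by rewrite mulr1 normcR gtr0_norm.
pose V := ball_point tc1 Vr.
have VJ : ncV J V.
  suff : J `<=` [set g | Ad g /\ g _ V = 0] by move=> JV g /JV[].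
  rewrite JG => g; apply; split; first exact: closed_ideal_vanishing.
  move=> {}g Gg; have Jg := generator_in_ideal Gg; split; first exact: JA.
  have [[k [s [d [sP gE]]]]|] := GF g Gg; last first.
    by apply=> i iNF /=; rewrite /C creation_notin// mulmx0 scaler0.
  (* a nonzero constant generator would put [1] in [J] *)
  have [k0|k0] := eqVneq k 0%N.
    have gc : g = (\sum_(w <- s) d w) *: (1 : ncmap R L).
      rewrite gE scaler_suml; apply: eq_big_seq => w /sP[+ _].
      by rewrite k0 => /size0nil ->; rewrite /monomial big_nil.
    have [d0|dN0] := eqVneq (\sum_(w <- s) d w) 0; first by rewrite gc d0 scale0r.
    case: J1; have := JZ (\sum_(w <- s) d w)^-1 _ Jg.
    by rewrite gc scalerA mulVf// scale1r.
  have -> : g _ V = (t ^+ k)%:C *: (E *m \sum_(w <- s) d w *: wprod C w).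
    rewrite gE ncmap_sumE mulmx_sumr scaler_sumr; apply: eq_big_seq => w /sP[wk _].
    rewrite ncmapZE monomialE wprod_compression//; last by rewrite -size_eq0 wk.
    by rewrite wk -scalemxAr !scalerA mulrC.
  rewrite (_ : E *m _ = 0) ?scaler0//; apply: mulmx_cV_eq0 => u.
  rewrite -mulmxA; apply: EP => j.
  rewrite (component_poly _ _ _ sP) -gE; case: ifP => // _.
  by apply: (JM _ _ _ Jg).2; apply: Ad_sum => x' _; exact/Ad_scale/Ad_monomial.
have VE : f _ V *m E = E *m f _ (fock_point F m t1).
  apply: nc_intertwine => [|i]; first exact: Ad_nc.
  by rewrite /= -scalemxAl ECE scalemxAr.
rewrite fV// mul0mx in VE.
pose a := col (findex F m [::]) (f _ (fock_point F m t1)).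
have Pa : P a.
  by rewrite -[a]subr0 -[X in _ - X](_ : E *m a = 0) // /a colE mulmxA -VE mul0mx.
have := JZ ((t ^+ r)%:C)^-1 _ (Pa r).
rewrite component_coef//; last exact: Ad_nc.
rewrite scalerA mulVf ?scale1r//.
by rewrite fmorph_eq0 expf_neq0// gt_eqF.
Qed.

(** Generators need not be polynomials over [F]: it is enough that the others
    vanish at all tuples supported on [F], as monomials with a letter outside
    [F] do. *)
Lemma ideal_of_zero_set f :
  (forall F0, exists2 F : {fset L}, {subset F0 <= F} &
     forall g, G g -> homogeneous_poly_in F g \/
     forall n (T : ncball R L n), (forall i, i \notin F -> sval T i = 0) -> g n T = 0) ->
  Ad f -> (forall n (T : ncball R L n), ncV J T -> f n T = 0) -> J f.
Proof.
move=> GF fA fV; have [[JA J0 JD JZ JM] Jcl] := Jideal.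
apply: Jcl => // e e0; have e2 : 0 < e / 2 by rewrite divr_gt0.
have [rho [m [F0 [_ fq]]]] := poly_approx fA e2.
have [F F0F {}GF] := GF F0.
exists (\sum_(w <- fockwords F m) ((rho ^+ size w)%:C * coef f w) *: @monomial R L w).
  rewrite big_fockwords; apply: ideal_sum => r _.
  have -> : \sum_(w <- words F r) ((rho ^+ size w)%:C * coef f w) *: @monomial R L w =
      (rho ^+ r)%:C *: \sum_(w <- words F r) coef f w *: @monomial R L w.
    rewrite scaler_sumr; apply: eq_big_seq => w.
    by rewrite mem_words => /andP[/eqP -> _]; rewrite scalerA.
  apply: JZ; apply: (@homogeneous_part_in_ideal f F m r GF fA fV).
  by rewrite -ltnS.
apply: (@le_lt_trans _ _ (e / 2)%:E).
  apply: supnorm_le (ltW e2) _ => n T; rewrite ncmapBE ncmap_sumE.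
  under eq_bigr do rewrite ncmapZE monomialE.
  exact: fq.
by rewrite lte_fin ltr_pdivrMr// mulr_natr mulr2n ltrDl.
Qed.

End Nullstellensatz.

Theorem theorem3p6 (R : realType) (L : choiceType) (J : set (ncmap R L))
  (hJ : closed_ideal J) (hhom : homogeneous J)
  (hgen : (exists2 G : set (ncmap R L),
             G `<=` range (@monomial R L) & generated_by J G)
          \/ (exists (L' : {fset L}) (G : set (ncmap R L)),
             G `<=` homogeneous_poly_in L' /\ generated_by J G)) :
  J = ncI (ncV J).
Proof.
have [[JA _ _ _ JM] _] := hJ.
rewrite eqEsubset; split=> [f Jf|f [fA fV]].
  by split; [exact: JA|move=> n T; exact].
have [J1|J1] := pselect (J 1).
  by rewrite -[f]mulr1; exact: (JM _ _ fA J1).1.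
case: hgen => [[G Gmon JG]|[L' [G [Gpoly JG]]]].
  apply: (ideal_of_zero_set hJ JG J1) => // F; exists F => // g /Gmon[w _ <-].
  have [wF|] := boolP (all (mem F) w).
    left; exists (size w), [:: w], (fun=> 1); split.
      by move=> u; rewrite inE => /eqP ->; split=> // i /(allP wF).
    by rewrite big_seq1 scale1r.
  move=> /allPn[i iw iNF]; right=> n T TF; rewrite monomialE.
  elim: w iw => // j w IH; rewrite inE wprod_cons => /predU1P[<-|/IH ->].
    by rewrite TF ?mul0mx.
  by rewrite mulmx0.
apply: (ideal_of_zero_set hJ JG J1) => // F.
exists (F `|` L')%fset => [i iF|g /Gpoly[k [s [c [sP ->]]]]].
  by rewrite in_fsetU iF.
left; exists k, s, c; split=> // w /sP[wk wL]; split=> // i /wL iL.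
by rewrite in_fsetU iL orbT.
Qed.
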